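(* Let $n\ge2$, $\ell\ge1$ and $N\ge2\ell$ be integers, let $\mu\in\mathbb{S}^{n-1}$ and $\kappa>0$, and let $X_1,\dots,X_N$ be i.i.d. with distribution $\mathrm{FvML}(\mu,\kappa)$. Then $$\widehat{A^{2\ell}}=\frac{D_{N,\ell}}{(N)_{2\ell}}$$ is an unbiased estimator of $A_n(\kappa)^{2\ell}$, i.e. $\mathbb{E}[\widehat{A^{2\ell}}]=A_n(\kappa)^{2\ell}$, where $(N)_{2\ell}=N(N-1)\cdots(N-2\ell+1)$ is the falling factorial.
   Context: $\mathbb{S}^{n-1}=\{x\in\mathbb{R}^n:\|x\|=1\}$ and $\sigma$ is its surface measure. For $\mu\in\mathbb{S}^{n-1}$ and $\kappa>0$, $\mathrm{FvML}(\mu,\kappa)$ is the probability measure on $\mathbb{S}^{n-1}$ with $\sigma$-density $f(x;\mu,\kappa)=C_n(\kappa)e^{\kappa\mu^\top x}$, where $C_n(\kappa)=\frac{\kappa^{n/2-1}}{(2\pi)^{n/2}I_{n/2-1}(\kappa)}$ is the normalizing constant and $I_\nu(\kappa)=\sum_{m\ge0}\frac{(\kappa/2)^{\nu+2m}}{m!\,\Gamma(\nu+m+1)}$ is the modified Bessel function of the first kind. $A_n(\kappa)=I_{n/2}(\kappa)/I_{n/2-1}(\kappa)$. $D_{N,\ell}=\sum (X_{i_1}\cdot X_{i_2})(X_{i_3}\cdot X_{i_4})\cdots(X_{i_{2\ell-1}}\cdot X_{i_{2\ell}})$, the sum running over all ordered $2\ell$-tuples $(i_1,\dots,i_{2\ell})$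 of distinct indices in $\{1,\dots,N\}$. *)

(* Defs.v *)
From HB Require Import structures.
From mathcomp Require Import all_boot all_order all_algebra.
From mathcomp Require Import all_classical all_reals all_analysis.
From mathcomp Require Import measurable_realfun.

Set Implicit Arguments.
Unset Strict Implicit.
Unset Printing Implicit Defensive.

Import Order.TTheory GRing.Theory Num.Theory.
Import numFieldNormedType.Exports.

Local Open Scope classical_set_scope.
Local Open Scope ring_scope.

(* R^n is [n.-tuple R], whose library sigma-algebra is the product one, i.e.
   the Borel sigma-algebra. *)

Section euclidean.
Context {R : realType} {n : nat}.
Implicit Types x y : n.-tuple R.

Definition dotp x y : R := \sum_(i < n) tnth x i * tnth y i.

Definition norm2 x : R := Num.sqrt (dotp x x).

Definition unit_sphere : set (n.-tuple R) := [set x | norm2 x = 1].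

Definition unit_vec x : n.-tuple R := [tuple (norm2 x)^-1 * tnth x i | i < n].

Definition punctured_ball : set (n.-tuple R) := [set x | 0 < norm2 x <= 1].

Lemma measurable_norm2 : measurable_fun [set: n.-tuple R] norm2.
Proof.
have mdot : measurable_fun [set: n.-tuple R] (fun x => dotp x x).
  by apply: measurable_sum => i; apply: measurable_funM; exact: measurable_tnth.
by apply: (measurableT_comp _ mdot); apply: continuous_measurable_fun;
  exact: sqrt_continuous.
Qed.

Lemma measurable_unit_vec : measurable_fun [set: n.-tuple R] unit_vec.
Proof.
apply/measurable_fun_tnthP => i.
rewrite (_ : _ \o _ = fun x => norm2 x `^ (-1) * tnth x i); last first.
  by apply/funext => x /=; rewrite tnth_mktuple powR_inv1// sqrtr_ge0.
apply: measurable_funM; last exact: measurable_tnth.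
by apply: (measurableT_comp (measurable_powR _)); exact: measurable_norm2.
Qed.

Lemma measurable_punctured_ball : measurable punctured_ball.
Proof.
rewrite (_ : punctured_ball = norm2 @^-1` `]0, 1]); last first.
  by apply/seteqP; split => x /=; rewrite in_itv.
by rewrite -[X in measurable X]setTI; exact: measurable_norm2.
Qed.

End euclidean.

Arguments unit_sphere {R} n.
Arguments punctured_ball {R} n.

Section lebesgue_tuple.
Context {R : realType}.
Local Open Scope ereal_scope.

Definition cons_pair n (p : R * n.-tuple R) : n.+1.-tuple R :=
  [tuple of p.1 :: p.2].

Lemma measurable_cons_pair n : measurable_fun setT (@cons_pair n).
Proof. exact: (measurable_cons measurable_fst measurable_snd). Qed.

Section step.
Variables (n : nat) (m : {sigma_finite_measure set (n.-tuple R) -> \bar R}).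

Definition lebesgue_cons : set (n.+1.-tuple R) -> \bar R :=
  pushforward (lebesgue_measure \x m) (@cons_pair n).

Let lebesgue_cons0 : lebesgue_cons set0 = 0.
Proof. by rewrite /lebesgue_cons /pushforward preimage_set0 measure0. Qed.

Let lebesgue_cons_ge0 A : 0 <= lebesgue_cons A.
Proof. by rewrite /lebesgue_cons /pushforward. Qed.

Let lebesgue_cons_sigma_additive : semi_sigma_additive lebesgue_cons.
Proof.
apply: measure_semi_sigma_additive; exact: measurable_cons_pair.
Qed.

HB.instance Definition _ := isMeasure.Build _ _ _ lebesgue_cons
  lebesgue_cons0 lebesgue_cons_ge0 lebesgue_cons_sigma_additive.

Let lebesgue_cons_sigma_finite : sigma_finite setT lebesgue_cons.
Proof.
have /sigma_finiteP[F [TF ndF Foo]] :=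
  @sigma_finiteT _ _ _ (@lebesgue_measure R).
have /sigma_finiteP[G [TG ndG Goo]] := sigma_finiteT m.
exists (fun k => [set t : n.+1.-tuple R |
    F k (thead t) /\ G k [tuple of behead t]]).
  rewrite predeqE => t; split=> // _.
  have : [set: R] (thead t) by [].
  have : [set: n.-tuple R] [tuple of behead t] by [].
  rewrite TF TG => -[j _ Gj] [i _ Fi]; exists (maxn i j) => //; split.
    by move: Fi; exact/subsetPset/ndF/leq_maxl.
  by move: Gj; exact/subsetPset/ndG/leq_maxr.
move=> k; have [mF Fk] := Foo k; have [mG Gk] := Goo k; split.
  apply: measurableI; rewrite -[X in measurable X]setTI.
    exact: (measurable_tnth ord0).
  exact: measurable_behead.
rewrite /lebesgue_cons /pushforward.
rewrite (_ : _ @^-1` _ = F k `*` G k).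
  by rewrite product_measure1E// lte_mul_pinfty// ge0_fin_numE.
apply/funext => -[x t]; rewrite /preimage /mkset /setX /= theadE.
by congr (_ /\ G k _); exact/val_inj.
Qed.

HB.instance Definition _ := Measure_isSigmaFinite.Build _ _ _ lebesgue_cons
  lebesgue_cons_sigma_finite.

End step.

Fixpoint lebesgue_tuple n : {sigma_finite_measure set (n.-tuple R) -> \bar R} :=
  if n is n'.+1 then lebesgue_cons (lebesgue_tuple n') else \d_([tuple]).

End lebesgue_tuple.

(* Surface measure of the unit sphere, through polar coordinates:
   sigma(A) = n * |{ r x : 0 < r <= 1, x in A, ||x|| = 1 }|.
   It is a measure on R^n carried by the sphere. *)
Definition sphere_measure {R : realType} n (A : set (n.-tuple R)) : \bar R :=
  (n%:R%:E * lebesgue_tuple n (punctured_ball n `&` unit_vec @^-1` A))%E.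

Section sphere_measure.
Context {R : realType} (n : nat).
Local Open Scope ereal_scope.

Let sphere_measure0 : @sphere_measure R n set0 = 0.
Proof. by rewrite /sphere_measure preimage_set0 setI0 measure0 mule0. Qed.

Let sphere_measure_ge0 A : 0 <= @sphere_measure R n A.
Proof. by rewrite mule_ge0// lee_fin. Qed.

Let sphere_measure_sigma_additive : semi_sigma_additive (@sphere_measure R n).
Proof.
move=> F mF tF mUF; rewrite /sphere_measure preimage_bigcup setI_bigcupr.
have mpre B : measurable B ->
    measurable (punctured_ball n `&` (unit_vec @^-1` B) : set (n.-tuple R)).
  move=> mB; apply: measurableI; first exact: measurable_punctured_ball.
  by rewrite -[X in measurable X]setTI; exact: measurable_unit_vec.
under eq_fun do rewrite -ge0_sume_distrr//.
apply: cvgeZl => //; apply: measure_semi_sigma_additive.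
- by move=> k; exact: mpre.
- apply/trivIsetP => /= i j _ _ ij; rewrite setIACA setIid -preimage_setI.
  by move/trivIsetP : tF => /(_ _ _ _ _ ij) ->//; rewrite preimage_set0 setI0.
- by rewrite -setI_bigcupr -preimage_bigcup; exact: mpre.
Qed.

HB.instance Definition _ := isMeasure.Build _ _ _ (@sphere_measure R n)
  sphere_measure0 sphere_measure_ge0 sphere_measure_sigma_additive.

End sphere_measure.

Section bessel.
Context {R : realType}.
Implicit Types (nu kappa s : R) (n : nat).

Definition Gamma s : R :=
  \int[lebesgue_measure]_(t in `]0, +oo[) (t `^ (s - 1) * expR (- t)).

Definition besselI nu kappa : R :=
  limn (series (fun m : nat =>
    (kappa / 2) `^ (nu + 2 * m%:R) / (m`!%:R * Gamma (nu + m%:R + 1)))).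

Definition FvML_const n kappa : R :=
  kappa `^ (n%:R / 2 - 1) /
  ((2 * pi) `^ (n%:R / 2) * besselI (n%:R / 2 - 1) kappa).

Definition bessel_ratio n kappa : R :=
  besselI (n%:R / 2) kappa / besselI (n%:R / 2 - 1) kappa.

Definition FvML_pdf n (mu : n.-tuple R) kappa (x : n.-tuple R) : R :=
  FvML_const n kappa * expR (kappa * dotp mu x).

Definition FvML n (mu : n.-tuple R) kappa (A : set (n.-tuple R)) : \bar R :=
  \int[@sphere_measure R n]_(x in A) (FvML_pdf mu kappa x)%:E.

End bessel.

Definition mutually_independent d d' (Omega : measurableType d)
    (T : measurableType d') (R : realType) (P : probability Omega R)
    (I : finType) (X : I -> {RV P >-> T}) :=
  forall (J : {set I}) (B : I -> set T), (forall i, measurable (B i)) ->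
    P (\bigcap_(i in [set` J]) (X i @^-1` B i)) =
    (\prod_(i in J) P (X i @^-1` B i))%E.

Section estimator.
Variables (R : realType) (n N l : nat).

Lemma even_index_lt (k : 'I_l) : (2 * k < 2 * l)%N.
Proof. by rewrite ltn_pmul2l. Qed.

Lemma odd_index_lt (k : 'I_l) : (2 * k + 1 < 2 * l)%N.
Proof. by rewrite addn1 !mul2n -doubleS ltn_Sdouble. Qed.

(* Indices start at 0: the k-th factor pairs the entries 2k and 2k+1 of t. *)
Definition D_stat (x : 'I_N -> n.-tuple R) : R :=
  \sum_(t : (2 * l).-tuple 'I_N | uniq t) \prod_(k < l)
    dotp (x (tnth t (Ordinal (even_index_lt k))))
         (x (tnth t (Ordinal (odd_index_lt k)))).

Definition A_estimator (x : 'I_N -> n.-tuple R) : R :=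
  D_stat x / (N ^_ (2 * l))%:R.

End estimator.

Arguments D_stat {R n N} l x.
Arguments A_estimator {R n N} l x.

(* Main.v *)
(* Write u(x) = x / |x| and let L[h] be the Lebesgue integral of h(u(x)) over the
   punctured unit ball, so that the integral of h against the surface measure is
   n L[h].  Scaling gives (n + d) L[h |x|^d] = n L[h].  Integrating the i-th
   partial derivative of (mu.x)^k (1 - |x|^2) over the ball gives 0, and in polar
   form this reads (n + k) L[u_i (mu.u)^(k+1)] = (k + 1) mu_i L[(mu.u)^k].  Hence,
   without any rotation invariance, L[u_i (mu.u)^k] = mu_i L[(mu.u)^(k+1)] and the
   moments of mu.u satisfy the two-step recursion of the coefficients of the Bessel
   series.  Summing the exponential series, L[u_i e^(kappa mu.u)] and
   L[e^(kappa mu.u)] have the ratio mu_i A_n(kappa); the constants L[1] and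
   Gamma(n/2) cancel because FvML has total mass 1 by hypothesis.  Thus each X_i
   has mean A_n(kappa) mu, and independence turns the expectation of each product
   of inner products into (A_n(kappa)^2 mu.mu)^l. *)

Require Import Defs.
From mathcomp Require Import all_boot all_order all_algebra finmap.
From mathcomp Require Import all_classical all_reals all_analysis.
From mathcomp Require Import measurable_realfun ring lra.

Import Order.TTheory GRing.Theory Num.Theory.
Import numFieldNormedType.Exports.

Local Open Scope classical_set_scope.
Local Open Scope ring_scope.

Set Implicit Arguments.
Unset Strict Implicit.

(** The surface measure, the law of the observations and independence are all given on sets only.
    Identities are therefore read on indicators and extended to bounded functions by one weighted
    lemma, [transfer], which serves polar moments, surface integrals, the mean of an observation and
    independence alike. The factor [1 - |x|^2] removes boundary terms: on each line parallel to a
    coordinate axis the integrated function is a polynomial that vanishes at both ends of the chord,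
    so one-variable calculus and Fubini take the place of a divergence theorem. The observations lie
    on the sphere only almost surely; normalizing them by [unit_vec] gives functions that are
    bounded everywhere and leaves expectations unchanged. Gamma enters only through its functional
    equation on [1, +oo), which covers all n/2 + j because n >= 2; that Gamma(n/2) is nonzero is
    deduced from the total mass of the law. *)

Section real_integral.
Context d (T : measurableType d) (R : realType).
Variables (m : {measure set T -> \bar R}) (D : set T) (mD : measurable D).
Implicit Types f g w : T -> R.

Lemma bounded_integrable f C : (m D < +oo)%E -> measurable_fun D f ->
  (forall x, D x -> `|f x| <= C) -> m.-integrable D (EFin \o f).
Proof.
move=> moo mf fC; apply: measurable_bounded_integrable => //.
by exists C; split => [|x Cx y Dy /=]; rewrite ?num_real// (le_trans (fC _ Dy))// ltW.
Qed.

Lemma integrable_bounded_mul f w C : measurable_fun D f ->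
  (forall x, D x -> `|f x| <= C) -> m.-integrable D (EFin \o w) ->
  m.-integrable D (EFin \o (fun x => f x * w x)).
Proof.
move=> mf fC iw.
rewrite (_ : _ \o _ = ((EFin \o f) \* (EFin \o w))%E)//.
apply: integrableMr => //.
by exists C; split => [|x Cx y Dy /=]; rewrite ?num_real// (le_trans (fC _ Dy))// ltW.
Qed.

Lemma dominated_cvg_Rintegral (f_ : nat -> T -> R) f g :
  (forall k, measurable_fun D (f_ k)) ->
  (forall x, D x -> f_ k x @[k --> \oo] --> f x) ->
  m.-integrable D (EFin \o g) ->
  (forall k x, D x -> `|f_ k x| <= g x) ->
  (\int[m]_(x in D) f_ k x) @[k --> \oo] --> \int[m]_(x in D) f x.
Proof.
move=> mf ff ig fg; apply: fine_cvg.
have mflim : measurable_fun D f by apply: (measurable_fun_cvg (h := f_)).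
(* The limit inherits the bound [g], so its integral is finite and [fine] can be undone. *)
rewrite fineK; last first.
  apply: integrable_fin_num => //; apply: (le_integrable mD _ _ ig).
    exact/measurable_EFinP.
  move=> x Dx /=; rewrite lee_fin (le_trans _ (ler_norm _))//.
  have cf : `|f_ k x| @[k --> \oo] --> `|f x| by apply: cvg_norm; exact: ff.
  rewrite -(cvg_lim (@norm_hausdorff _ _) cf); apply: limr_le.
    by apply/cvg_ex; exists `|f x|.
  by apply: nearW => k; exact: fg.
apply: (@dominated_cvg _ _ _ _ _ mD _ _ (EFin \o g)) => //.
- by move=> k; exact/measurable_EFinP.
- by move=> x Dx; apply: cvg_EFin; [exact: nearW|exact: ff].
Qed.

Lemma integrableZl_EFin c f : m.-integrable D (EFin \o f) ->
  m.-integrable D (EFin \o (fun x => c * f x)).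
Proof. by move=> /(integrableZl mD c); apply: eq_integrable. Qed.

Lemma integrable_sum_EFin (I : eqType) (s : seq I) (h : I -> T -> R) :
  (forall i, i \in s -> m.-integrable D (EFin \o h i)) ->
  m.-integrable D (EFin \o (fun x => \sum_(i <- s) h i x)).
Proof.
elim: s => [_|i s ih hs].
  by under [EFin \o _]eq_fun do rewrite /= big_nil; exact: integrable0.
under [EFin \o _]eq_fun do rewrite /= big_cons EFinD.
apply: integrableD => //; first by apply: hs; rewrite mem_head.
by apply: ih => j js; apply: hs; rewrite in_cons js orbT.
Qed.

Lemma Rintegral_sum (I : eqType) (s : seq I) (h : I -> T -> R) :
  (forall i, i \in s -> m.-integrable D (EFin \o h i)) ->
  \int[m]_(x in D) (\sum_(i <- s) h i x) =
  \sum_(i <- s) \int[m]_(x in D) h i x.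
Proof.
elim: s => [_|i s ih hs].
  rewrite big_nil; under eq_Rintegral do rewrite big_nil.
  by rewrite Rintegral_cst// mul0r.
rewrite big_cons -ih; last by move=> j js; apply: hs; rewrite in_cons js orbT.
rewrite -RintegralD//; first by under eq_Rintegral do rewrite big_cons.
- by apply: hs; rewrite mem_head.
- by apply: integrable_sum_EFin => j js; apply: hs; rewrite in_cons js orbT.
Qed.

End real_integral.

(** * Extension of integral identities from indicators to bounded functions *)

Section transfer.
Context d1 (T1 : measurableType d1) d2 (T2 : measurableType d2)
  d (T : measurableType d) (R : realType).
Variables (m1 : {measure set T1 -> \bar R}) (m2 : {measure set T2 -> \bar R}).
Variables (D1 : set T1) (D2 : set T2) (mD1 : measurable D1) (mD2 : measurable D2).
Variables (X : T1 -> T) (Y : T2 -> T) (W : T1 -> R) (V : T2 -> R).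
Hypotheses (mX : measurable_fun setT X) (mY : measurable_fun setT Y).
Hypothesis iW : m1.-integrable D1 (EFin \o W).
Hypothesis iV : m2.-integrable D2 (EFin \o V).
Hypothesis XY : forall B, measurable B ->
  \int[m1]_(x in D1) (\1_B (X x) * W x) = \int[m2]_(y in D2) (\1_B (Y y) * V y).

Import HBNNSimple.

Let transfer_nnsfun (g : {nnsfun T >-> R}) :
  \int[m1]_(x in D1) (g (X x) * W x) = \int[m2]_(y in D2) (g (Y y) * V y).
Proof.
have gE x : g x = \sum_(r <- fset_set (range g)) r * \1_(g @^-1` [set r]) x.
  by rewrite fimfunE fsbig_finite.
have gE' x w : g x * w =
    \sum_(r <- fset_set (range g)) r * (\1_(g @^-1` [set r]) x * w).
  by rewrite gE mulr_suml; apply: eq_bigr => r _; rewrite mulrA.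
under eq_Rintegral do rewrite gE'.
under [RHS]eq_Rintegral do rewrite gE'.
have mpre r : measurable (g @^-1` [set r]) by [].
have indic_le1 r x : `|\1_(g @^-1` [set r]) x| <= 1 :> R.
  by rewrite indicE; case: (_ \in _); rewrite ?normr0 ?normr1.
have i1 r : m1.-integrable D1
    (EFin \o (fun x => \1_(g @^-1` [set r]) (X x) * W x)).
  apply: (integrable_bounded_mul mD1 (C := 1)) => //.
  by apply: measurable_funTS; apply: (measurableT_comp _ mX); exact: measurable_indic.
have i2 r : m2.-integrable D2
    (EFin \o (fun x => \1_(g @^-1` [set r]) (Y x) * V x)).
  apply: (integrable_bounded_mul mD2 (C := 1)) => //.
  by apply: measurable_funTS; apply: (measurableT_comp _ mY); exact: measurable_indic.
rewrite !Rintegral_sum//.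
- apply: eq_bigr => r _.
  by rewrite !RintegralZl// XY.
- by move=> r _; exact: integrableZl_EFin.
- by move=> r _; exact: integrableZl_EFin.
Qed.

Let transfer_ge0 (g : T -> R) C : measurable_fun setT g ->
  (forall x, 0 <= g x <= C) ->
  \int[m1]_(x in D1) (g (X x) * W x) = \int[m2]_(y in D2) (g (Y y) * V y).
Proof.
move=> mg gC.
have mg' : measurable_fun setT (EFin \o g) by exact/measurable_EFinP.
have g0 x : [set: T] x -> (0 <= (EFin \o g) x)%E.
  by move=> _; rewrite lee_fin; have /andP[] := gC x.
pose a := nnsfun_approx measurableT mg'.
have aC k x : `|a k x| <= C.
  rewrite ger0_norm//.
  rewrite -lee_fin (le_trans (y := (g x)%:E))//; last first.
    by rewrite lee_fin; have /andP[] := gC x.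
  by rewrite /a nnsfun_approxE; apply: le_approx.
have ag x : a k x @[k --> \oo] --> g x.
  by have /fine_cvg := cvg_nnsfun_approx measurableT mg' g0 (I : setT x).
have c1 : (\int[m1]_(x in D1) (a k (X x) * W x)) @[k --> \oo] -->
    \int[m1]_(x in D1) (g (X x) * W x).
  apply: (dominated_cvg_Rintegral mD1 (g := fun x => C * `|W x|)).
  - move=> k; apply: measurable_funM.
      by apply: measurable_funTS; exact: measurableT_comp.
    by have /measurable_int/measurable_EFinP := iW.
  - by move=> x _; apply: cvgM; [exact: ag|exact: cvg_cst].
  - by apply: integrableZl_EFin => //; exact: integrable_norm.
  - by move=> k x _; rewrite normrM ler_wpM2r.
have c2 : (\int[m2]_(x in D2) (a k (Y x) * V x)) @[k --> \oo] -->
    \int[m2]_(x in D2) (g (Y x) * V x).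
  apply: (dominated_cvg_Rintegral mD2 (g := fun x => C * `|V x|)).
  - move=> k; apply: measurable_funM.
      by apply: measurable_funTS; exact: measurableT_comp.
    by have /measurable_int/measurable_EFinP := iV.
  - by move=> x _; apply: cvgM; [exact: ag|exact: cvg_cst].
  - by apply: integrableZl_EFin => //; exact: integrable_norm.
  - by move=> k x _; rewrite normrM ler_wpM2r.
move/cvg_lim : c1 => <- //; move/cvg_lim : c2 => <- //.
by congr (limn _); apply/funext => k; exact: transfer_nnsfun.
Qed.

(** [XY] says that the image under [X] of the signed measure with density [W] equals the image under
    [Y] of the one with density [V]. Linearity gives simple functions, dominated convergence (by
    [C * |W|] and [C * |V|]) gives bounded nonnegative ones, and a shift by [C] gives the rest. The
    total masses that the shift brings in agree by [XY] on the whole space. *)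
Lemma transfer (g : T -> R) C : measurable_fun setT g ->
  (forall x, `|g x| <= C) ->
  \int[m1]_(x in D1) (g (X x) * W x) = \int[m2]_(y in D2) (g (Y y) * V y).
Proof.
move=> mg gC.
have mgC : measurable_fun setT (fun x => g x + C) by exact: measurable_funD.
have gC0 x : 0 <= g x + C <= C + C.
  by have := gC x; rewrite ler_norml => /andP[g1 g2]; lra.
have i1 : m1.-integrable D1 (EFin \o (fun x => (g (X x) + C) * W x)).
  apply: (integrable_bounded_mul mD1 (C := C + C)) => //.
    by apply: measurable_funTS; exact: (measurableT_comp mgC).
  by move=> x _; have /andP[g1 g2] := gC0 (X x); rewrite ger0_norm.
have i2 : m2.-integrable D2 (EFin \o (fun x => (g (Y x) + C) * V x)).
  apply: (integrable_bounded_mul mD2 (C := C + C)) => //.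
    by apply: measurable_funTS; exact: (measurableT_comp mgC).
  by move=> x _; have /andP[g1 g2] := gC0 (Y x); rewrite ger0_norm.
have E1 : \int[m1]_(x in D1) (g (X x) * W x) =
    \int[m1]_(x in D1) ((g (X x) + C) * W x) - C * \int[m1]_(x in D1) W x.
  rewrite -RintegralZl// -RintegralB//; last first.
    exact: integrableZl_EFin.
  by apply: eq_Rintegral => x _; ring.
have E2 : \int[m2]_(x in D2) (g (Y x) * V x) =
    \int[m2]_(x in D2) ((g (Y x) + C) * V x) - C * \int[m2]_(x in D2) V x.
  rewrite -RintegralZl// -RintegralB//; last first.
    exact: integrableZl_EFin.
  by apply: eq_Rintegral => x _; ring.
have E3 : \int[m1]_(x in D1) W x = \int[m2]_(x in D2) V x.
  have := XY measurableT.
  under eq_Rintegral do rewrite indicT mul1r.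
  by under [in RHS]eq_Rintegral do rewrite indicT mul1r.
by rewrite E1 E2 E3 (transfer_ge0 mgC gC0).
Qed.

End transfer.

(** * Lebesgue measure on tuples and its scaling *)

Lemma ge0_lebesgue_integral_scale (R : realType) (s : R) (f : R -> \bar R) :
  0 < s -> measurable_fun setT f -> (forall x, 0 <= f x)%E ->
  (s%:E * \int[lebesgue_measure]_t f (s * t)%R =
   \int[lebesgue_measure]_t f t)%E.
Proof.
move=> s0 mf f0.
have ms : measurable_fun [set: measurableTypeR R] (fun t => s * t : measurableTypeR R).
  exact: mulrl_measurable.
(* The canonical instance is named because unification cannot guess [ms]. *)
pose m : {measure set (measurableTypeR R) -> \bar R} :=
  mscale (NngNum (ltW s0))
    (measure_function_pushforward__canonical__measure_function_Measure
       lebesgue_measure ms).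
transitivity (\int[m]_t f t)%E.
  rewrite ge0_integral_mscale//=; congr (_ * _)%E.
  by rewrite [RHS](ge0_integral_pushforward ms _ measurableT mf).
(* By uniqueness of Lebesgue measure it is enough to compare the rescaled image measure with it on
   half-open intervals. *)
apply/esym/eq_measure_integral => A mA _.
apply: lebesgue_measure_unique => //= _ [[a b]] _ <-.
rewrite /m /mscale /= /pushforward.
rewrite (_ : _ @^-1` _ = `](a / s), (b / s)]%classic); last first.
  apply/seteqP; split => x /=; rewrite !in_itv/=.
    by rewrite ltr_pdivrMr// ler_pdivlMr// ![x * s]mulrC.
  by rewrite ltr_pdivrMr// ler_pdivlMr// ![x * s]mulrC.
rewrite !lebesgue_measure_itv/= !lte_fin ltr_pM2r ?invr_gt0//.
case: ifPn => _; last by rewrite mule0.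
by rewrite -!EFinB -EFinM; congr EFin; field; rewrite gt_eqF.
Qed.

Section lebesgue_tuple_theory.
Context {R : realType}.

(* Lebesgue measure lives on [measurableTypeR R], whose sigma-algebra is only
   convertible to the one [measurable_cons_pair] is stated with. *)
Lemma measurable_cons_pairR n :
  measurable_fun [set: (measurableTypeR R * n.-tuple R)%type] (@cons_pair R n).
Proof. exact: measurable_cons_pair. Qed.

Lemma ge0_integral_lebesgue_tupleS n (f : n.+1.-tuple R -> \bar R) :
  measurable_fun setT f -> (forall x, 0 <= f x)%E ->
  (\int[lebesgue_tuple n.+1]_x f x =
   \int[lebesgue_measure]_t \int[lebesgue_tuple n]_y f (cons_pair (t, y)))%E.
Proof.
move=> mf f0.
pose m := measure_function_pushforward__canonical__measure_function_Measure
  (lebesgue_measure \x lebesgue_tuple n)%E (@measurable_cons_pairR n).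
transitivity (\int[m]_x f x)%E; first exact: eq_measure_integral.
rewrite [LHS](ge0_integral_pushforward (@measurable_cons_pairR n) _ measurableT mf)//.
rewrite preimage_setT fubini_tonelli1//; last by move=> x; exact: f0.
exact: (measurableT_comp mf (@measurable_cons_pairR n)).
Qed.

Definition scale_tuple n (s : R) (x : n.-tuple R) : n.-tuple R :=
  [tuple s * tnth x i | i < n].

Lemma measurable_scale_tuple n s :
  measurable_fun [set: n.-tuple R] (scale_tuple s).
Proof.
apply/measurable_fun_tnthP => i.
rewrite (_ : _ \o _ = fun x => s * tnth x i); last first.
  by apply/funext => x /=; rewrite tnth_mktuple.
by apply: measurable_funM => //; exact: measurable_tnth.
Qed.

Lemma scale_tuple_cons n s t (y : n.-tuple R) :
  scale_tuple s (cons_pair (t, y)) = cons_pair (s * t, scale_tuple s y).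
Proof.
apply: eq_from_tnth => i; rewrite tnth_mktuple.
case: (unliftP ord0 i) => [j|] ->; last by rewrite !tnth0.
by rewrite !tnthS tnth_mktuple.
Qed.

(** Each coordinate contributes one factor [s]: Tonelli splits off the first one, to which the
    one-dimensional case applies, and the induction hypothesis handles the others. *)
Lemma ge0_integral_scale_tuple n (s : R) (f : n.-tuple R -> \bar R) : 0 < s ->
  measurable_fun setT f -> (forall x, 0 <= f x)%E ->
  ((s ^+ n)%:E * \int[lebesgue_tuple n]_x f (scale_tuple s x) =
   \int[lebesgue_tuple n]_x f x)%E.
Proof.
move=> s0; elim: n f => [|n ih] f mf f0.
  rewrite expr0 mul1e; apply: eq_integral => x _; congr f.
  by apply: eq_from_tnth => -[].
have mf2 t : measurable_fun setT (fun y => f (cons_pair (t, y))).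
  apply: (measurableT_comp mf); apply: (measurableT_comp (@measurable_cons_pairR n)).
  exact: measurable_pair1.
have mg : measurable_fun [set: measurableTypeR R]
    (fun t => \int[lebesgue_tuple n]_y f (cons_pair (t, y)))%E.
  apply: (@measurable_fun_fubini_tonelli_F _ _ _ _ _ (lebesgue_tuple n)
    (f \o @cons_pair R n)) => [|x]; last exact: f0.
  exact: (measurableT_comp mf (@measurable_cons_pairR n)).
rewrite !ge0_integral_lebesgue_tupleS//; last first.
  by apply: (measurableT_comp mf); exact: measurable_scale_tuple.
rewrite -[RHS](@ge0_lebesgue_integral_scale R s)//; last first.
  by move=> t; apply: integral_ge0.
rewrite exprS EFinM -muleA; congr (_ * _)%E.
under eq_integral do under eq_integral do rewrite scale_tuple_cons.
rewrite -ge0_integralZl//.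
- by apply: eq_integral => t _; rewrite -ih.
(* Measurability in [t] is also read off from the induction hypothesis, which turns the inner
   integral into a constant multiple of the measurable function of [mg], taken at [s * t]. *)
- have -> : (fun t => \int[lebesgue_tuple n]_y
      f (cons_pair ((s * t)%R, scale_tuple s y)))%E =
    (fun t => (s ^- n)%:E * (\int[lebesgue_tuple n]_y f (cons_pair ((s * t)%R, y))))%E.
    apply/funext => t; rewrite -[in RHS]ih// muleA -EFinM mulVf ?mul1e//.
    by rewrite expf_neq0// gt_eqF.
  apply: measurable_funeM; apply: (measurableT_comp mg).
  exact: mulrl_measurable.
- by move=> t _; apply: integral_ge0.
- by rewrite lee_fin exprn_ge0// ltW.
Qed.

(** A bounding set for the unit ball that, unlike the ball, is a product, so that its measure is
    finite directly from the recursive construction of Lebesgue measure. *)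
Definition cube n : set (n.-tuple R) := [set x | forall i, `|tnth x i| <= 1].

Arguments cube : clear implicits.

Lemma preimage_cons_pair_cube n :
  @cons_pair R n @^-1` cube n.+1 = [set t | `|t| <= 1] `*` cube n.
Proof.
apply/seteqP; split => [[t y] h|[t y] [/= ht hy] i]/=.
  split => [|i]/=; first by have := h ord0; rewrite tnth0.
  by have := h (lift ord0 i); rewrite tnthS.
by case: (unliftP ord0 i) => [j|] ->; rewrite ?tnth0 ?tnthS.
Qed.

Lemma measurable_cube n : measurable (cube n).
Proof.
rewrite (_ : cube n = \bigcap_(i in [set: 'I_n]) [set x | `|tnth x i| <= 1]).
  apply: fin_bigcap_measurable => // i _.
  rewrite (_ : [set x | _] = (fun x : n.-tuple R => `|tnth x i|) @^-1` `]-oo, 1]).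
    rewrite -[X in measurable X]setTI.
    have : measurable_fun [set: n.-tuple R] (fun x => `|tnth x i|).
      by apply: measurableT_comp => //; exact: measurable_tnth.
    by apply.
  by apply/seteqP; split => x /=; rewrite in_itv.
by apply/seteqP; split => [x h i _|x h i]; [exact: h|exact: h].
Qed.

Lemma lebesgue_tuple_cube_lty n : (lebesgue_tuple n (cube n) < +oo)%E.
Proof.
elim: n => [|n ih].
  by rewrite /= diracE; case: (_ \in _); rewrite ltey.
rewrite /= /lebesgue_cons /pushforward preimage_cons_pair_cube.
rewrite (_ : [set t | _] = `[(-1 : R), 1]%classic); last first.
  by apply/seteqP; split => x /=; rewrite in_itv/= ler_norml.
rewrite product_measure1E//; last exact: measurable_cube.
have E : @lebesgue_measure R `[(-1), 1]%classic = 2%:E.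
  rewrite lebesgue_measure_itv/= lte_fin ifT; last by lra.
  by rewrite -EFinB; congr EFin; lra.
by rewrite [X in (X * _)%E]E lte_mul_pinfty// lee_fin.
Qed.

End lebesgue_tuple_theory.

Arguments cube {R} n.

(** * Fubini along a single coordinate *)

Section coordinate_fubini.
Context {R : realType}.

Definition subst_tuple n (i : 'I_n) (t : R) (x : n.-tuple R) : n.-tuple R :=
  [tuple if j == i then t else tnth x j | j < n].

Lemma subst_tuple_cons0 n s t (y : n.-tuple R) :
  subst_tuple ord0 t (cons_pair (s, y)) = cons_pair (t, y).
Proof.
apply: eq_from_tnth => k; rewrite tnth_mktuple.
by case: (unliftP ord0 k) => [j|] ->; rewrite ?eqxx ?tnth0 // !tnthS.
Qed.

Lemma subst_tuple_consS n (i : 'I_n) s t (y : n.-tuple R) :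
  subst_tuple (lift ord0 i) t (cons_pair (s, y)) = cons_pair (s, subst_tuple i t y).
Proof.
apply: eq_from_tnth => k; rewrite tnth_mktuple.
case: (unliftP ord0 k) => [j|] ->; last by rewrite !tnth0.
by rewrite !tnthS tnth_mktuple (inj_eq lift_inj).
Qed.

Lemma integrable_bounded_support d (T : measurableType d)
    (m : {measure set T -> \bar R}) (A : set T) (f : T -> R) C :
  measurable A -> (m A < +oo)%E -> measurable_fun setT f ->
  (forall x, `|f x| <= C) -> (forall x, ~ A x -> f x = 0) ->
  m.-integrable setT (EFin \o f).
Proof.
move=> mA Aoo mf fC fA.
have -> : EFin \o f = (EFin \o f) \_ A.
  apply/funext => x; rewrite patchE; case: ifPn => //.
  by rewrite notin_setE => Ax; rewrite /= fA.
apply/(integrable_mkcond _ mA); apply: (bounded_integrable mA Aoo) => //.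
exact: measurable_funTS.
Qed.

(** Fubini with the [i]-th coordinate as innermost variable. As [g] is signed, boundedness and
    support in the cube supply the integrability that Fubini asks for. *)
Lemma integral_coordinate_eq0 n (i : 'I_n) (g : n.-tuple R -> R) C :
  measurable_fun setT g -> (forall x, `|g x| <= C) ->
  (forall x, ~ cube n x -> g x = 0) ->
  (forall x, \int[lebesgue_measure]_t (g (subst_tuple i t x))%:E = 0)%E ->
  (\int[lebesgue_tuple n]_x (g x)%:E = 0)%E.
Proof.
elim: n i g => [[]//|n ih] i g mg gC gcube gi.
have mgc : measurable_fun setT (g \o @cons_pair R n).
  exact: (measurableT_comp mg (@measurable_cons_pairR R n)).
have ig : (lebesgue_measure \x lebesgue_tuple n)%E.-integrable setT
    (EFin \o (g \o @cons_pair R n)).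
  have mA : measurable ([set: measurableTypeR R * n.-tuple R] `&`
      @cons_pair R n @^-1` cube n.+1).
    by apply: (@measurable_cons_pairR R n) => //; exact: measurable_cube.
  rewrite setTI in mA.
  apply: (integrable_bounded_support mA _ mgc (C := C)).
  - exact: (lebesgue_tuple_cube_lty n.+1).
  - by move=> x; exact: gC.
  - by move=> x; exact: gcube.
pose m := measure_function_pushforward__canonical__measure_function_Measure
  (lebesgue_measure \x lebesgue_tuple n)%E (@measurable_cons_pairR R n).
transitivity (\int[m]_x (g x)%:E)%E; first exact: eq_measure_integral.
have mEg : measurable_fun setT (EFin \o g) by exact/measurable_EFinP.
rewrite [LHS](integral_pushforward (@measurable_cons_pairR R n) mEg ig measurableT) preimage_setT.
(* If the coordinate is not the first, the first is integrated last and each slice vanishes by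
   induction; if it is the first, the order of integration is swapped. *)
case: (unliftP ord0 i) gi => [j|] -> gi.
- rewrite -integral12_prod_meas1//; apply: integral0_eq => t _.
  apply: (ih j (fun y => g (cons_pair (t, y)))) => [|y|y ny|y].
  + by apply: (measurableT_comp mgc); exact: measurable_pair1.
  + exact: gC.
  + apply: gcube => h; apply: ny => k.
    by have := h (lift ord0 k); rewrite tnthS.
  + rewrite -[RHS](gi (cons_pair (t, y))).
    by under [RHS]eq_integral do rewrite subst_tuple_consS.
- rewrite -integral21_prod_meas1//; apply: integral0_eq => y _.
  (* The 0 is a placeholder, overwritten by [subst_tuple ord0]. *)
  rewrite -[RHS](gi (cons_pair (0, y))).
  by under [RHS]eq_integral do rewrite subst_tuple_cons0.
Qed.

End coordinate_fubini.

(** * Integration by parts on the unit ball *)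

Section ball_integration_by_parts.
Context {R : realType}.

(** The primitive vanishes at both ends of [-sqrt a, sqrt a]. Here [t ^+ 2 <= a] is the chord cut
    from the unit ball by a line parallel to an axis, with [a] equal to 1 minus the other squared
    coordinates; [a < 0] is a line that misses the ball, [a = 0] a tangent one. *)
Lemma integral_deriv_vanishing_ends (q : {poly R}) (a : R) :
  (\int[lebesgue_measure]_t
    (((t : R) ^+ 2 <= a)%R%:R * (q * (a%:P - 'X^2))^`().[t])%:E = 0)%E.
Proof.
set p := q * _.
have [a0|a0] := ltP a 0.
  apply: integral0_eq => t _.
  by rewrite leNgt (lt_le_trans a0 (sqr_ge0 t)) mul0r.
set s : R := Num.sqrt a.
have sa : s ^+ 2 = a by rewrite sqr_sqrtr.
transitivity (\int[lebesgue_measure]_(t in `[(- s)%R, s]) (p^`().[t])%:E)%E.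
  rewrite [RHS]integral_mkcond; apply: eq_integral => t _; rewrite patchE.
  have -> : (t \in `[(- s), s]%classic) = (t ^+ 2 <= a).
    rewrite mem_setE in_itv/= -ler_norml -sa -(real_normK (num_real t)).
    by rewrite ler_sqr ?nnegrE ?sqrtr_ge0.
  by case: ifPn => _; rewrite ?mul1r ?mul0r.
have [s0|s0] := ltP 0 s; last first.
  have -> : s = 0 by apply/eqP; rewrite eq_le s0 sqrtr_ge0.
  by rewrite oppr0 set_itv1 integral_set1.
rewrite (@continuous_FTC2 R (horner p^`()) (horner p)).
- rewrite -EFinB !hornerE !sqrrN sa; congr EFin; ring.
- by lra.
- by apply: continuous_subspaceT; exact: continuous_horner.
- split=> [t _| |]; first exact: derivable_horner.
  + exact/cvg_at_right_filter/continuous_horner.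
  + exact/cvg_at_left_filter/continuous_horner.
- by move=> t _; rewrite derivE.
Qed.

Lemma measurable_dotp n (mu : n.-tuple R) : measurable_fun setT (dotp mu).
Proof.
by apply: measurable_sum => i; apply: measurable_funM => //; exact: measurable_tnth.
Qed.

Lemma measurable_dotp_sqr n : measurable_fun setT (fun x : n.-tuple R => dotp x x).
Proof.
by apply: measurable_sum => i; apply: measurable_funM; exact: measurable_tnth.
Qed.

(** A crude substitute for Cauchy-Schwarz, for the places where integrability asks only for some
    constant. *)
Lemma dotp_cube_le n (mu x : n.-tuple R) : cube n x ->
  `|dotp mu x| <= \sum_(i < n) `|tnth mu i|.
Proof.
move=> hx; apply: (le_trans (ler_norm_sum _ _ _)); apply: ler_sum => i _.
by rewrite normrM ler_piMr.
Qed.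

Lemma unit_ball_cube n (x : n.-tuple R) : dotp x x <= 1 -> cube n x.
Proof.
move=> hx i; rewrite -(@ler_sqr _ `|tnth x i| 1)// ?nnegrE//.
rewrite real_normK ?num_real// expr1n (le_trans _ hx)//.
rewrite /dotp (bigD1 i)//= expr2 lerDl sumr_ge0// => j _.
by rewrite -expr2 sqr_ge0.
Qed.

Lemma dotp_subst n (mu : n.-tuple R) i t x :
  dotp mu (subst_tuple i t x) =
  tnth mu i * t + \sum_(j < n | j != i) tnth mu j * tnth x j.
Proof.
rewrite /dotp (bigD1 i)//= tnth_mktuple eqxx; congr (_ + _).
by apply: eq_bigr => j ji; rewrite tnth_mktuple (negbTE ji).
Qed.

Lemma dotp_subst_sqr n i t (x : n.-tuple R) :
  dotp (subst_tuple i t x) (subst_tuple i t x) =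
  t ^+ 2 + \sum_(j < n | j != i) tnth x j ^+ 2.
Proof.
rewrite /dotp (bigD1 i)//= tnth_mktuple eqxx -expr2; congr (_ + _).
by apply: eq_bigr => j ji; rewrite tnth_mktuple (negbTE ji) -expr2.
Qed.

(* The integrand is the i-th partial derivative of (mu.x)^k (1 - |x|^2), a
   function that vanishes on the boundary of the unit ball. *)
Lemma ball_integration_by_parts n (mu : n.-tuple R) (i : 'I_n) (k : nat) :
  (\int[lebesgue_tuple n]_x ((dotp x x <= 1)%R%:R *
    (tnth mu i * k%:R * dotp mu x ^+ k.-1 * (1 - dotp x x) -
     2 * (tnth x i * dotp mu x ^+ k)))%:E = 0)%E.
Proof.
have mmu := measurable_dotp mu.
have msqr := @measurable_dotp_sqr n.
have mind : measurable_fun setT (fun x : n.-tuple R => (dotp x x <= 1)%R%:R : R).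
  apply: (measurableT_comp (f := fun b : bool => b%:R : R)) => //.
  exact: measurable_fun_ler.
set S := \sum_(i < n) `|tnth mu i|.
apply: (integral_coordinate_eq0 (i := i)
  (C := `|tnth mu i| * k%:R * S ^+ k.-1 + 2 * S ^+ k)).
- apply: measurable_funM => //; apply: measurable_funB; apply: measurable_funM => //.
  + by apply: measurable_funM => //; exact: measurable_funX.
  + exact: measurable_funB.
  + by apply: measurable_funM; [exact: measurable_tnth|exact: measurable_funX].
- move=> x; case: (boolP (dotp x x <= 1)) => hx; last first.
    by rewrite mul0r normr0 addr_ge0// !mulr_ge0// exprn_ge0// sumr_ge0.
  have cx := unit_ball_cube hx.
  have hmu := dotp_cube_le mu cx.
  rewrite mul1r (le_trans (ler_normB _ _))// lerD//.
    have x0 : 0 <= dotp x x by apply: sumr_ge0 => j _; rewrite -expr2 sqr_ge0.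
    rewrite !normrM (ger0_norm (ler0n _ _)) normrX.
    rewrite -[leRHS]mulr1 ler_pM//; last by rewrite ler_norml; lra.
    by rewrite ler_wpM2l ?mulr_ge0// lerXn2r// nnegrE// (le_trans _ hmu).
  rewrite normrM (@ger0_norm _ 2)// ler_wpM2l// normrM normrX.
  rewrite -[leRHS]mul1r ler_pM//.
  by rewrite lerXn2r// nnegrE// (le_trans _ hmu).
- move=> x nx; case: (boolP (dotp x x <= 1)) => hx; last by rewrite mul0r.
  by case: nx; exact: unit_ball_cube.
(* Along the [i]-th axis, |x|^2 = t^2 + c and mu.x = mu_i t + b, so the integrand is the derivative
   of (mu_i t + b)^k (1 - c - t^2), cut off at t^2 <= 1 - c. *)
- move=> x; set c := \sum_(j < n | j != i) tnth x j ^+ 2.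
  set b := \sum_(j < n | j != i) tnth mu j * tnth x j.
  rewrite -[RHS](integral_deriv_vanishing_ends
    ((tnth mu i *: 'X + b%:P) ^+ k) (1 - c)).
  apply: eq_integral => t _; rewrite dotp_subst_sqr -/c dotp_subst -/b.
  rewrite tnth_mktuple eqxx lerBrDr; congr (_ * _)%:E.
  rewrite derivM deriv_exp derivB derivXn derivD derivZ derivX !derivC.
  rewrite !(hornerE, hornerMn)/= -[in RHS]mulr_natr.
  ring.
Qed.

End ball_integration_by_parts.

(** * Polar coordinates and radial moments of cones *)

Section polar_coordinates.
Context {R : realType}.

Lemma norm2_ge0 n (x : n.-tuple R) : 0 <= norm2 x.
Proof. exact: sqrtr_ge0. Qed.

Lemma dotp_sqr_ge0 n (x : n.-tuple R) : 0 <= dotp x x.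
Proof. by apply: sumr_ge0 => i _; rewrite -expr2 sqr_ge0. Qed.

Lemma norm2_sqr n (x : n.-tuple R) : norm2 x ^+ 2 = dotp x x.
Proof. by rewrite sqr_sqrtr// dotp_sqr_ge0. Qed.

Lemma norm2_scale n s (x : n.-tuple R) : 0 < s ->
  norm2 (scale_tuple s x) = s * norm2 x.
Proof.
move=> s0; rewrite /norm2.
have -> : dotp (scale_tuple s x) (scale_tuple s x) = s ^+ 2 * dotp x x.
  by rewrite /dotp mulr_sumr; apply: eq_bigr => i _; rewrite !tnth_mktuple; ring.
by rewrite sqrtrM ?sqr_ge0// sqrtr_sqr gtr0_norm.
Qed.

Lemma unit_vec_scale n s (x : n.-tuple R) : 0 < s ->
  unit_vec (scale_tuple s x) = unit_vec x.
Proof.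
move=> s0; apply: eq_from_tnth => i; rewrite !tnth_mktuple norm2_scale//.
by rewrite invfM mulrACA mulVf ?gt_eqF// mul1r.
Qed.

Lemma tnth_norm2_unit_vec n (x : n.-tuple R) i : 0 < norm2 x ->
  tnth x i = norm2 x * tnth (unit_vec x) i.
Proof. by move=> x0; rewrite tnth_mktuple mulrA divff ?mul1r// gt_eqF. Qed.

Lemma dotp_norm2_unit_vec n (mu x : n.-tuple R) : 0 < norm2 x ->
  dotp mu x = norm2 x * dotp mu (unit_vec x).
Proof.
move=> x0; rewrite /dotp mulr_sumr; apply: eq_bigr => i _.
by rewrite {1}(tnth_norm2_unit_vec _ x0) mulrCA.
Qed.

(** True at the origin too, where the convention [0^-1 = 0] makes [unit_vec] the zero vector. *)
Lemma cube_unit_vec n (x : n.-tuple R) : cube n (unit_vec x).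
Proof.
apply: unit_ball_cube.
have -> : dotp (unit_vec x) (unit_vec x) = (norm2 x)^-1 ^+ 2 * norm2 x ^+ 2.
  rewrite norm2_sqr /dotp mulr_sumr.
  by apply: eq_bigr => i _; rewrite !tnth_mktuple; ring.
rewrite -exprMn; have [->|x0] := eqVneq (norm2 x) 0.
  by rewrite mulr0 expr0n.
by rewrite mulVf// expr1n.
Qed.

Lemma unit_vec_sphere n (x : n.-tuple R) : unit_sphere n x -> unit_vec x = x.
Proof.
by move=> x1; apply: eq_from_tnth => i; rewrite tnth_mktuple x1 invr1 mul1r.
Qed.

Lemma norm2_unit_vec n (x : n.-tuple R) : 0 < norm2 x -> unit_sphere n (unit_vec x).
Proof.
move=> x0; rewrite /unit_sphere /= /norm2.
have -> : dotp (unit_vec x) (unit_vec x) = (norm2 x)^-1 ^+ 2 * norm2 x ^+ 2.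
  rewrite norm2_sqr /dotp mulr_sumr.
  by apply: eq_bigr => i _; rewrite !tnth_mktuple; ring.
by rewrite -exprMn mulVf ?gt_eqF// expr1n sqrtr1.
Qed.

Lemma punctured_ball_cube n : @punctured_ball R n `<=` cube n.
Proof.
move=> x /andP[x0 x1]; apply: unit_ball_cube.
by rewrite -norm2_sqr expr_le1// norm2_ge0.
Qed.

Lemma punctured_ball_lty n :
  (lebesgue_tuple n (@punctured_ball R n) < +oo)%E.
Proof.
apply: le_lt_trans (lebesgue_tuple_cube_lty n).
apply: le_measure; [apply/mem_set..|].
- exact: measurable_punctured_ball.
- exact: measurable_cube.
- exact: punctured_ball_cube.
Qed.

Lemma ler_horner_at1 (p q : {poly R}) :
  (forall s, 0 < s < 1 -> p.[s] <= q.[s]) -> p.[1] <= q.[1].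
Proof.
move=> pq.
have cp : horner p @ (1 : R)^'- --> p.[1].
  by apply: cvg_at_left_filter; exact: continuous_horner.
have cq : horner q @ (1 : R)^'- --> q.[1].
  by apply: cvg_at_left_filter; exact: continuous_horner.
apply: (ler_cvg_to cp cq); near=> s; apply: pq; apply/andP; split.
  by near: s; apply: nbhs_left_gt.
by near: s; exact: nbhs_left_lt.
Unshelve. all: by end_near. Qed.

Section cone.
Variables (n : nat) (A : set (n.-tuple R)).
Hypotheses (n0 : (0 < n)%N) (mA : measurable A).

Let F d s (x : n.-tuple R) : R :=
  \1_A (unit_vec x) * (0 < norm2 x <= s)%R%:R * norm2 x ^+ d.

Let mind s : measurable_fun setT
  (fun x : n.-tuple R => (0 < norm2 x <= s)%R%:R : R).
Proof.
apply: (measurableT_comp (f := fun b : bool => b%:R : R)) => //.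
have mn := @measurable_norm2 R n.
by apply: measurable_and; [exact: measurable_fun_ltr|exact: measurable_fun_ler].
Qed.

Let mF d s : measurable_fun setT (F d s).
Proof.
apply: measurable_funM; last by apply: measurable_funX; exact: measurable_norm2.
apply: measurable_funM; last exact: mind.
exact: (measurableT_comp (measurable_indic mA) measurable_unit_vec).
Qed.

Let F_ge0 d s x : 0 <= F d s x.
Proof. by rewrite !mulr_ge0// ?exprn_ge0// norm2_ge0. Qed.

Let iF d s : 0 < s <= 1 -> (lebesgue_tuple n).-integrable setT (EFin \o F d s).
Proof.
move=> /andP[_ s1].
have Fout x : ~ punctured_ball n x -> F d s x = 0.
  rewrite /F => xB; case: (boolP (0 < norm2 x <= s)); rewrite ?(mulr0,mul0r)//.
  by case/andP => x0 xs; case: xB; rewrite /punctured_ball /= x0 (le_trans xs).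
apply: (integrable_bounded_support (A := punctured_ball n) (C := 1)) => //.
- exact: measurable_punctured_ball.
- exact: punctured_ball_lty.
- move=> x; rewrite ger0_norm//.
  have [/andP[x0 x1]|/Fout ->//] := pselect (punctured_ball n x).
  have h1 : \1_A (unit_vec x) * (0 < norm2 x <= s)%R%:R <= 1 :> R.
    by rewrite indicE; case: (_ \in _); case: (0 < _ <= _);
      rewrite ?(mulr0, mulr1).
  by rewrite /F mulr_ile1 ?exprn_ge0 ?exprn_ile1 ?norm2_ge0// mulr_ge0.
Qed.

Let J d s : R := \int[lebesgue_tuple n]_x F d s x.

Let iF1 d : (lebesgue_tuple n).-integrable setT (EFin \o F d 1).
Proof. by apply: iF; rewrite ltr01 lexx. Qed.

(** Scaling by [s] carries the cone truncated at radius 1 to the one truncated at radius [s]; the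
    volume gives [s ^+ n] and the weight [s ^+ d]. *)
Let J_scale d s : 0 < s -> J d s = s ^+ (n + d) * J d 1.
Proof.
move=> s0; rewrite {1}/J /Rintegral.
rewrite -(@ge0_integral_scale_tuple _ _ s)//;
  [|apply/measurable_EFinP; exact: mF|by move=> x; rewrite lee_fin].
have FE x : F d s (scale_tuple s x) = s ^+ d * F d 1 x.
  rewrite /F unit_vec_scale// norm2_scale// pmulr_rgt0// exprMn.
  by rewrite -[X in (_ <= X)%R]mulr1 ler_pM2l//; ring.
under eq_integral do rewrite FE EFinM.
rewrite integralZl//; last exact: iF1.
rewrite muleA -EFinM -exprD fineM//.
by apply: integrable_fin_num => //; exact: iF1.
Qed.

Let J_shell d s : 0 < s <= 1 ->
  J d 1 - J d s = \int[lebesgue_tuple n]_x (F d 1 x - F d s x).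
Proof. by move=> s01; rewrite RintegralB//; exact: iF. Qed.

(** On the shell s < |x| <= 1 the weight |x|^d lies between s^d and 1. *)
Let shell_ineq d s : 0 < s <= 1 ->
  s ^+ d * (J 0 1 - J 0 s) <= J d 1 - J d s <= J 0 1 - J 0 s.
Proof.
move=> /andP[s0 s1].
have i1 k : (lebesgue_tuple n).-integrable setT
    (EFin \o (fun x => F k 1 x - F k s x)).
  have iFs : (lebesgue_tuple n).-integrable setT (EFin \o F k s).
    by apply: iF; rewrite s0.
  exact: (integrableB measurableT (iF1 k) iFs).
rewrite !J_shell ?s0// -RintegralZl//.
have FE k x : F k 1 x - F k s x =
    \1_A (unit_vec x) * (s < norm2 x <= 1)%R%:R * norm2 x ^+ k.
  rewrite /F; have [xs|xs] := leP (norm2 x) s.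
    by rewrite (le_trans xs s1) mulr0 mul0r; ring.
  by rewrite (lt_trans s0 xs) /= mulr0 mul0r subr0.
apply/andP; split; apply: le_Rintegral => //.
- exact: integrableZl_EFin.
- move=> x _; rewrite !FE expr0 mulr1.
  case: (boolP (s < norm2 x <= 1)) => [/andP[sx _]|_]; last by rewrite !(mulr0,mul0r).
  rewrite mulr1 mulrC ler_wpM2l// lerXn2r ?nnegrE ?norm2_ge0//; first exact: ltW.
  exact: ltW.
- move=> x _; rewrite !FE expr0.
  case: (boolP (s < norm2 x <= 1)) => [/andP[_ x1]|_]; last by rewrite !(mulr0,mul0r).
  by rewrite !mulr1 ler_piMr// exprn_ile1// norm2_ge0.
Qed.

(** By scaling, the shell bounds place (1 - s^(n+d)) J_d between s^d (1 - s^n) J_0 and (1 - s^n)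
    J_0, where J_k stands for [J k 1]. Dividing by 1 - s and letting s tend to 1 from below gives (n
    + d) J_d = n J_0, with no radial integration. *)
Lemma cone_moment d :
  (n + d)%:R *
  \int[lebesgue_tuple n]_(x in punctured_ball n) (\1_A (unit_vec x) * norm2 x ^+ d) =
  n%:R * \int[lebesgue_tuple n]_(x in punctured_ball n) \1_A (unit_vec x) :> R.
Proof.
have JE k : J k 1 = \int[lebesgue_tuple n]_(x in punctured_ball n)
    (\1_A (unit_vec x) * norm2 x ^+ k).
  rewrite Rintegral_mkcond; apply: eq_Rintegral => x _.
  rewrite /F patchE; have [xB|xB] := pselect (punctured_ball n x).
    by rewrite (mem_set xB); rewrite /punctured_ball /= in xB; rewrite xB mulr1.
  rewrite (memNset xB); rewrite /punctured_ball /= in xB.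
  by move/negP/negbTE : xB => ->; rewrite mulr0 mul0r.
have <- : J 0 1 = \int[lebesgue_tuple n]_(x in punctured_ball n) \1_A (unit_vec x).
  by rewrite JE; apply: eq_Rintegral => x _; rewrite expr0 mulr1.
rewrite -JE.
(* The quotient (1 - X^k) / (1 - X), whose value at 1 is k: the division by 1 - s is done on
   polynomials, and the limit is evaluation at 1. *)
pose q k : {poly R} := \poly_(i < k) 1.
have qE k s : s ^+ k = 1 - (1 - s) * (q k).[s].
  rewrite /q horner_poly; under eq_bigr do rewrite mul1r.
  by have := subrX1 s k => /eqP; rewrite subr_eq => /eqP ->; ring.
have q1 k : (q k).[1] = k%:R.
  rewrite /q horner_poly; under eq_bigr do rewrite mul1r expr1n.
  by rewrite sumr_const card_ord.
have key s : 0 < s < 1 ->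
  ('X^d * q n * (J 0 1)%:P).[s] <= (q (n + d)%N * (J d 1)%:P).[s] <=
    (q n * (J 0 1)%:P).[s].
  move=> /andP[s0 s1]; have := @shell_ineq d s; rewrite s0 (ltW s1) => /(_ isT).
  rewrite !(J_scale _ s0) addn0 (qE n) (qE (n + d)%N) !hornerE.
  have s10 : 0 < 1 - s by rewrite subr_gt0.
  set a := J d 1; set b := J 0 1; set v := s ^+ d.
  set c := (q n).[s]; set e := (q (n + d)%N).[s].
  have -> : b - (1 - (1 - s) * c) * b = (1 - s) * (c * b) by ring.
  have -> : a - (1 - (1 - s) * e) * a = (1 - s) * (e * a) by ring.
  by rewrite mulrCA !(ler_pM2l s10) mulrA.
apply/eqP; rewrite eq_le -!q1; apply/andP; split.
  have := @ler_horner_at1 (q (n + d)%N * (J d 1)%:P) (q n * (J 0 1)%:P).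
  rewrite !hornerE; apply => s /key /andP[_].
  by rewrite !hornerE.
have := @ler_horner_at1 ('X^d * q n * (J 0 1)%:P) (q (n + d)%N * (J d 1)%:P).
rewrite !hornerE expr1n mul1r; apply => s /key /andP[+ _].
by rewrite !hornerE.
Qed.

End cone.

End polar_coordinates.

(** * Radial moments of bounded functions of the direction *)

Section sphere_moments.
Context {R : realType}.

Lemma integrable_punctured_ball n (f : n.-tuple R -> R) (C : R) :
  measurable_fun setT f -> (forall x, punctured_ball n x -> `|f x| <= C) ->
  (lebesgue_tuple n).-integrable (punctured_ball n) (EFin \o f).
Proof.
move=> mf fC.
apply: (@bounded_integrable _ _ _ (lebesgue_tuple n) _
  (@measurable_punctured_ball R n) f C) => //.
- exact: punctured_ball_lty.
- exact: measurable_funTS.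
Qed.

Lemma integrable_norm2X n d :
  (lebesgue_tuple n).-integrable (@punctured_ball R n)
    (EFin \o (fun x => norm2 x ^+ d)).
Proof.
apply: (@integrable_punctured_ball _ _ 1).
  by apply: measurable_funX; exact: measurable_norm2.
move=> x /andP[x0 x1]; rewrite ger0_norm ?exprn_ge0 ?norm2_ge0//.
by rewrite exprn_ile1// norm2_ge0.
Qed.

(** [cone_moment] is the case of an indicator; [transfer] extends it, with weight |x|^d on one side
    and the constant n / (n + d) on the other. *)
Lemma polar_moment n d (h : n.-tuple R -> R) (C : R) : (0 < n)%N ->
  measurable_fun setT h -> (forall x, `|h x| <= C) ->
  (n + d)%:R *
    \int[lebesgue_tuple n]_(x in punctured_ball n) (h (unit_vec x) * norm2 x ^+ d) =
  n%:R * \int[lebesgue_tuple n]_(x in punctured_ball n) h (unit_vec x).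
Proof.
move=> n0 mh hC; have mB := @measurable_punctured_ball R n.
have mu := @measurable_unit_vec R n.
have nd0 : (n + d)%:R != 0 :> R by rewrite pnatr_eq0 addn_eq0 negb_and -lt0n n0.
have ih : (lebesgue_tuple n).-integrable (punctured_ball n)
    (EFin \o (fun x => h (unit_vec x))).
  by apply: (@integrable_punctured_ball _ _ C) => //; exact: (measurableT_comp mh mu).
have icst c : (lebesgue_tuple n).-integrable (@punctured_ball R n)
    (EFin \o (fun=> c)).
  by apply: (@integrable_punctured_ball _ _ `|c|).
have -> : \int[lebesgue_tuple n]_(x in punctured_ball n)
    (h (unit_vec x) * norm2 x ^+ d) =
  \int[lebesgue_tuple n]_(x in punctured_ball n)
    (h (unit_vec x) * (n%:R / (n + d)%:R)).
  apply: (transfer mB mB mu mu (integrable_norm2X n d) (icst _) _ mh hC) => B mBB.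
  rewrite RintegralZr//; last first.
    apply: (@integrable_punctured_ball _ _ 1).
      exact: (measurableT_comp (measurable_indic mBB) mu).
    by move=> x _; rewrite indicE; case: (_ \in _); rewrite ?normr0 ?normr1.
  apply: (mulfI nd0); rewrite cone_moment//.
  by field; rewrite -natrD.
by rewrite RintegralZr//; field; rewrite -natrD.
Qed.

(** The set is invariant under scaling by 1/2 and has finite measure, so this measure equals 2^-n
    times itself; as n > 0, it is 0. *)
Lemma norm2_eq0_null n : (0 < n)%N ->
  lebesgue_tuple n [set x : n.-tuple R | norm2 x = 0] = 0%E.
Proof.
move=> n0; set Z := [set x | _].
have mZ : measurable Z.
  rewrite (_ : Z = norm2 @^-1` [set 0])//.
  by rewrite -[X in measurable X]setTI; exact: measurable_norm2.
have Zoo : (lebesgue_tuple n Z < +oo)%E.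
  apply: le_lt_trans (lebesgue_tuple_cube_lty n).
  apply: le_measure; [apply/mem_set..|] => //; first exact: measurable_cube.
  by move=> x Zx; apply: unit_ball_cube; rewrite -norm2_sqr Zx expr0n.
have s0 : 0 < 2^-1 :> R by rewrite invr_gt0.
have mi : measurable_fun setT (EFin \o (\1_Z : n.-tuple R -> R)).
  by apply/measurable_EFinP; exact: measurable_indic.
have i0 (x : n.-tuple R) : (0 <= (EFin \o (\1_Z : _ -> R)) x)%E by rewrite lee_fin.
have := ge0_integral_scale_tuple s0 mi i0.
have ZE x : \1_Z (scale_tuple 2^-1 x) = \1_Z x :> R.
  rewrite !indicE; congr (_ %:R); congr nat_of_bool.
  apply/idP/idP; rewrite !inE /Z /= norm2_scale//; last by move=> ->; rewrite mulr0.
  by move/eqP; rewrite mulf_eq0 invr_eq0 pnatr_eq0/= => /eqP.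
rewrite /=; under eq_integral do rewrite ZE.
rewrite integral_indic// setIT.
have fZ : lebesgue_tuple n Z \is a fin_num by rewrite ge0_fin_numE.
move=> /(congr1 fine); rewrite fineM//= => /eqP.
rewrite -subr_eq0 -[X in _ - X]mul1r -mulrBl mulf_eq0 => /orP[|/eqP Z0]; last first.
  by rewrite -(fineK fZ) Z0.
rewrite subr_eq0 => /eqP h.
have : (2^-1 : R) ^+ n < 1 by rewrite exprn_ilt1 ?gtn_eqF// invf_lt1// ltr1n.
by rewrite h ltxx.
Qed.

(** Integration by parts lives on the closed ball, polar coordinates on the punctured one; the two
    differ by the null set |x| = 0. *)
Lemma integral_unit_ball n (g : n.-tuple R -> R) : (0 < n)%N ->
  measurable_fun setT g ->
  (\int[lebesgue_tuple n]_x ((dotp x x <= 1)%R%:R * g x)%:E =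
   \int[lebesgue_tuple n]_(x in punctured_ball n) (g x)%:E)%E.
Proof.
move=> n0 mg; rewrite [RHS]integral_mkcond.
apply: ae_eq_integral => //.
- apply/measurable_EFinP; apply: measurable_funM => //.
  apply: (measurableT_comp (f := fun b : bool => b%:R : R)) => //.
  by apply: measurable_fun_ler => //; exact: measurable_dotp_sqr.
- apply/(measurable_restrictT _ (@measurable_punctured_ball R n)).
  by apply/measurable_EFinP; exact: measurable_funTS.
- exists [set x | norm2 x = 0]; split.
  + rewrite (_ : [set x | _] = norm2 @^-1` [set 0])//.
    by rewrite -[X in measurable X]setTI; exact: measurable_norm2.
  + exact: norm2_eq0_null.
  + move=> x /= /not_implyP[_]; apply: contra_notP => x0.
    have {}x0 : 0 < norm2 x by rewrite lt_neqAle norm2_ge0 andbT eq_sym; apply/eqP.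
    rewrite patchE -norm2_sqr.
    have -> : (norm2 x ^+ 2 <= 1) = (norm2 x <= 1).
      by rewrite expr_le1// norm2_ge0.
    have [xB|xB] := pselect (punctured_ball n x).
      rewrite (mem_set xB); rewrite /punctured_ball /= in xB.
      by case/andP: xB => _ ->; rewrite mul1r.
    rewrite (memNset xB); rewrite /punctured_ball /= x0 /= in xB.
    by move/negP/negbTE : xB => ->; rewrite mul0r.
Qed.

End sphere_moments.

(** * Recursions for the moments of the direction *)

Section directional_moments.
Context {R : realType}.
Variables (n : nat) (mu : n.-tuple R).
Hypothesis n0 : (0 < n)%N.

Let S : R := \sum_(i < n) `|tnth mu i|.

Let S0 : 0 <= S. Proof. exact: sumr_ge0. Qed.

Definition dir_moment k : R :=
  \int[lebesgue_tuple n]_(x in punctured_ball n) dotp mu (unit_vec x) ^+ k.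

Definition coord_moment i k : R :=
  \int[lebesgue_tuple n]_(x in punctured_ball n)
    (tnth (unit_vec x) i * dotp mu (unit_vec x) ^+ k).

(* Composition with unit_vec makes the coordinates bounded on all of R^n. *)
Let w (x : n.-tuple R) := dotp mu (unit_vec x).
Let c i (x : n.-tuple R) := tnth (unit_vec x) i.

Let mw : measurable_fun setT w.
Proof. exact: (measurableT_comp (measurable_dotp mu) measurable_unit_vec). Qed.

Let mc i : measurable_fun setT (c i).
Proof. exact: (measurableT_comp (measurable_tnth i) measurable_unit_vec). Qed.

Let wX_le k x : `|w x ^+ k| <= S ^+ k.
Proof.
by rewrite normrX lerXn2r// ?nnegrE//; exact/dotp_cube_le/cube_unit_vec.
Qed.

Let cw_le i k x : `|c i x * w x ^+ k| <= S ^+ k.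
Proof. by rewrite normrM -[leRHS]mul1r ler_pM//; exact: cube_unit_vec. Qed.

(** [polar_moment] composes its argument with [unit_vec], and so do the bounded functions it is
    applied to here; this removes the double normalization. *)
Let unit_vecK x : punctured_ball n x ->
  unit_vec (unit_vec x) = unit_vec x :> n.-tuple R.
Proof. by case/andP => x0 _; apply/unit_vec_sphere/norm2_unit_vec. Qed.

Let polar_w k d : (n + d)%:R *
    \int[lebesgue_tuple n]_(x in punctured_ball n) (w x ^+ k * norm2 x ^+ d) =
  n%:R * dir_moment k.
Proof.
have := @polar_moment R n d (fun x => w x ^+ k) (S ^+ k) n0
  (measurable_funX k mw) (wX_le k).
rewrite /dir_moment /w.
have E : {in punctured_ball n, forall x : n.-tuple R,
    dotp mu (unit_vec (unit_vec x)) ^+ k = dotp mu (unit_vec x) ^+ k}.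
  by move=> x /set_mem xB; rewrite unit_vecK.
rewrite (eq_Rintegral _ E) => <-; congr (_ * _).
by apply: eq_Rintegral => x xB; rewrite E.
Qed.

Let polar_cw i k d : (n + d)%:R *
    \int[lebesgue_tuple n]_(x in punctured_ball n)
      (c i x * w x ^+ k * norm2 x ^+ d) =
  n%:R * coord_moment i k.
Proof.
have := @polar_moment R n d (fun x => c i x * w x ^+ k) (S ^+ k) n0
  (measurable_funM (mc i) (measurable_funX k mw)) (cw_le i k).
rewrite /coord_moment /w /c.
have E : {in punctured_ball n, forall x : n.-tuple R,
    tnth (unit_vec (unit_vec x)) i * dotp mu (unit_vec (unit_vec x)) ^+ k =
    tnth (unit_vec x) i * dotp mu (unit_vec x) ^+ k}.
  by move=> x /set_mem xB; rewrite unit_vecK.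
rewrite (eq_Rintegral _ E) => <-; congr (_ * _).
by apply: eq_Rintegral => x xB; rewrite E.
Qed.

Let iw k d : (lebesgue_tuple n).-integrable (punctured_ball n)
  (EFin \o (fun x => w x ^+ k * norm2 x ^+ d)).
Proof.
apply: (integrable_bounded_mul (@measurable_punctured_ball R n) _ _
  (integrable_norm2X n d)); last by move=> x _; exact: wX_le.
by apply: measurable_funTS; exact: measurable_funX.
Qed.

Let icw i k d : (lebesgue_tuple n).-integrable (punctured_ball n)
  (EFin \o (fun x => c i x * w x ^+ k * norm2 x ^+ d)).
Proof.
apply: (integrable_bounded_mul (@measurable_punctured_ball R n) _ _
  (integrable_norm2X n d)); last by move=> x _; exact: cw_le.
by apply: measurable_funTS; apply: measurable_funM => //; exact: measurable_funX.
Qed.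

(** [ball_integration_by_parts] after the substitutions x_i = |x| u_i and mu.x = |x| (mu.u). *)
Let polar_parts i k :
  tnth mu i * k%:R *
    (\int[lebesgue_tuple n]_(x in punctured_ball n)
       (w x ^+ k.-1 * norm2 x ^+ k.-1) -
     \int[lebesgue_tuple n]_(x in punctured_ball n)
       (w x ^+ k.-1 * norm2 x ^+ k.+1)) =
  2 * \int[lebesgue_tuple n]_(x in punctured_ball n)
       (c i x * w x ^+ k * norm2 x ^+ k.+1).
Proof.
have mB := @measurable_punctured_ball R n.
have := ball_integration_by_parts mu i k.
rewrite integral_unit_ball//; last first.
  have mmu := measurable_dotp mu; have msqr := @measurable_dotp_sqr R n.
  apply: measurable_funB; apply: measurable_funM => //.
  - by apply: measurable_funM => //; exact: measurable_funX.
  - exact: measurable_funB.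
  - by apply: measurable_funM; [exact: measurable_tnth|exact: measurable_funX].
move/(congr1 fine); rewrite /= -/(Rintegral _ _ _).
pose f x := tnth mu i * k%:R *
    (w x ^+ k.-1 * norm2 x ^+ k.-1 - w x ^+ k.-1 * norm2 x ^+ k.+1) -
    2 * (c i x * w x ^+ k * norm2 x ^+ k.+1).
rewrite (@eq_Rintegral _ _ _ _ _ f); last first.
  move=> x /set_mem /andP[x0 _].
  rewrite (tnth_norm2_unit_vec _ x0) (dotp_norm2_unit_vec mu x0) -norm2_sqr /f {f}.
  (* For [k = 0] the predecessor is truncated, but the term that contains it carries the factor
     [k%:R = 0]. *)
  case: k => [|k]; first by rewrite !(mulr0, mul0r, expr0, expr1, mulr1) /c; ring.
  by rewrite /= !exprMn !exprS /w /c; ring.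
have i1 := iw k.-1 k.-1; have i2 := iw k.-1 k.+1; have i3 := icw i k k.+1.
have i12 := integrableB mB i1 i2.
rewrite RintegralB//; last 2 first.
- exact: (integrableZl_EFin mB (tnth mu i * k%:R) i12).
- exact: (integrableZl_EFin mB 2 i3).
rewrite !RintegralZl// RintegralB//.
by move/eqP; rewrite subr_eq0 => /eqP.
Qed.

(** The case [k = 0] of integration by parts, where the derivative falls on 1 - |x|^2 alone; it does
    the work of the symmetry x -> -x. *)
Lemma coord_moment0 i : coord_moment i 0 = 0.
Proof.
have := polar_parts i 0; rewrite mulr0 mul0r => /esym/eqP.
rewrite mulf_eq0 pnatr_eq0/= => /eqP h.
have := polar_cw i 0 1; rewrite h mulr0 => /esym/eqP.
by rewrite mulf_eq0 pnatr_eq0 gtn_eqF//= => /eqP.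
Qed.

(** In [polar_parts] at [k.+1] the radial degrees are k, k + 2 and k + 2; removing them by polar
    moments leaves 1/(n + k) - 1/(n + k + 2) = 2 / ((n + k)(n + k + 2)), and the factor n + k + 2
    cancels. *)
Lemma coord_momentS i k :
  (n + k)%:R * coord_moment i k.+1 = k.+1%:R * (tnth mu i * dir_moment k).
Proof.
have := polar_parts i k.+1; rewrite /=.
have nz m : (n + m)%:R != 0 :> R by rewrite pnatr_eq0 addn_eq0 negb_and -lt0n n0.
have n0' : n%:R != 0 :> R by rewrite pnatr_eq0 -lt0n.
have div m (a b : R) : (n + m)%:R * a = b -> a = b / (n + m)%:R.
  by move=> <-; rewrite mulrAC divff ?mul1r.
rewrite (div _ _ _ (polar_w k k)) (div _ _ _ (polar_w k k.+2)).
rewrite (div _ _ _ (polar_cw i k.+1 k.+2)).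
have a2 := nz k.+2; have a0 := nz k; move: a2 a0.
have -> : (n + k.+2)%:R = (n + k)%:R + 2 :> R by rewrite -natrD -addnA addn2.
set a : R := (n + k)%:R; set m := dir_moment k; set v := coord_moment i k.+1.
set e := tnth mu i; set b : R := n%:R; set j : R := k.+1%:R => a2 a0 h.
have : (a + 2) * (2 * (b * v / (a + 2))) =
   (a + 2) * (e * j * (b * m / a - b * m / (a + 2))) by rewrite h.
have -> : (a + 2) * (2 * (b * v / (a + 2))) = 2 * b * v.
  by field; rewrite -(natrD _ n k) -/a a2.
have -> : (a + 2) * (e * j * (b * m / a - b * m / (a + 2))) =
   2 * b * (e * j * m / a).
  by field; rewrite -(natrD _ n k) -/a a0 a2.
move/(mulfI _) => ->; last by rewrite mulf_neq0// pnatr_eq0.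
by field; rewrite -(natrD _ n k) -/a a0.
Qed.

Hypothesis mu1 : dotp mu mu = 1.

Lemma dir_momentS k : dir_moment k.+1 = \sum_(i < n) tnth mu i * coord_moment i k.
Proof.
have mB := @measurable_punctured_ball R n.
have ic i : (lebesgue_tuple n).-integrable (punctured_ball n)
    (EFin \o (fun x => c i x * w x ^+ k)).
  apply: eq_integrable (icw i k 0) => // x _.
  by rewrite /= expr0 mulr1.
transitivity (\int[lebesgue_tuple n]_(x in punctured_ball n)
    (\sum_(i < n) tnth mu i * (c i x * w x ^+ k))).
  apply: eq_Rintegral => x _; rewrite exprS {1}/dotp mulr_suml.
  by apply: eq_bigr => i _; rewrite mulrA.
rewrite Rintegral_sum//; last by move=> i _; exact: integrableZl_EFin.
by apply: eq_bigr => i _; rewrite RintegralZl.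
Qed.

Lemma dir_moment1 : dir_moment 1 = 0.
Proof. by rewrite dir_momentS big1// => i _; rewrite coord_moment0 mulr0. Qed.

Lemma dir_momentSS k : (n + k)%:R * dir_moment k.+2 = k.+1%:R * dir_moment k.
Proof.
rewrite dir_momentS mulr_sumr.
transitivity (\sum_(i < n) k.+1%:R * dir_moment k * (tnth mu i * tnth mu i)).
  by apply: eq_bigr => i _; rewrite mulrCA coord_momentS; ring.
by rewrite -mulr_sumr -/(dotp mu mu) mu1 mulr1.
Qed.

(** At k = 0 both sides vanish; at k + 1 both become (k + 1) mu_i L[(mu.u)^k] when multiplied by n +
    k. *)
Lemma coord_momentE i k : coord_moment i k = tnth mu i * dir_moment k.+1.
Proof.
case: k => [|k]; first by rewrite coord_moment0 dir_moment1 mulr0.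
have nz : (n + k)%:R != 0 :> R by rewrite pnatr_eq0 addn_eq0 negb_and -lt0n n0.
by apply: (mulfI nz); rewrite coord_momentS [RHS]mulrCA dir_momentSS; ring.
Qed.

End directional_moments.

(** * Functional equation of the Gamma function *)

Section gamma_recursion.
Context {R : realType}.
Variable s : R.
Hypothesis s1 : 1 <= s.

Let f (a t : R) := t `^ a * expR (- t).

Let f_ge0 a t : 0 <= f a t. Proof. by rewrite mulr_ge0 ?powR_ge0 ?expR_ge0. Qed.

Let mexpN : measurable_fun [set: R] (fun t => expR (- t)).
Proof. by apply: measurableT_comp. Qed.

Let mf a : measurable_fun setT (f a).
Proof. by apply: measurable_funM => //; exact: measurable_powR. Qed.

(** With an integer m >= s and t >= 1, e^t >= t^(m+1) / (m+1)! gives t^s e^(-t) <= (m+1)! / t. *)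
Let cvg_boundary : f s n.+1%:R @[n --> \oo] --> 0.
Proof.
pose m := (Num.truncn s).+1.
have sm : s <= m%:R by rewrite ltW// truncnS_gt.
apply: (@squeeze_cvgr _ _ _ _ (cst 0) (fun n => m.+1`!%:R * harmonic n)).
- apply: nearW => n; rewrite f_ge0/= /f expRN ler_pdivrMr ?expR_gt0//.
  have n0 : 0 < n.+1%:R :> R by rewrite ltr0n.
  have n1 : 1 <= n.+1%:R :> R by rewrite ler1n.
  apply: (@le_trans _ _ (n.+1%:R ^+ m)).
    by rewrite -powR_mulrn ?ler0n// ler_powR.
  have e1 : n.+1%:R ^+ m.+1 / m.+1`!%:R <= expR n.+1%:R :> R.
    by have := expR_ge1Dxn m (ltW n0); lra.
  rewrite -ler_pdivrMl; last by rewrite mulr_gt0 ?invr_gt0// ltr0n fact_gt0.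
  apply: le_trans e1; rewrite /harmonic /= invfM invrK exprS.
  by rewrite le_eqVlt -subr_eq0; apply/orP; left; apply/eqP; ring.
- exact: cvg_cst.
- rewrite -[X in _ --> X](mulr0 (m.+1`!%:R)).
  by apply: cvgM; [exact: cvg_cst|exact: cvg_harmonic].
Qed.

Let continuous_powR (a b : R) : 0 <= a -> 0 < b -> 
  {within `[0, b], continuous (fun t : R => t `^ a)}.
Proof.
move=> a0 b0; have cin (x : R) : 0 < x -> {for x, continuous (fun t : R => t `^ a)}.
  move=> x0; apply: differentiable_continuous; apply/derivable1_diffP.
  by apply: derivable_powR; rewrite in_itv/= x0.
apply/(continuous_within_itvP _ b0); split.
- by move=> x; rewrite in_itv/= => /andP[x0 _]; exact: cin.
(* The exponent 0, which arises for s = 1, is apart: the power is then 1 at the origin, and 0 for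
   positive exponents. *)
- have [->|an0] := eqVneq a 0.
    by under eq_fun do rewrite powRr0; rewrite powRr0; exact: cvg_cst.
  by rewrite powR0//; apply: powR_cvg0; rewrite lt_neqAle eq_sym an0.
- by apply: cvg_at_left_filter; exact: cin.
Qed.

Let parts n : (\int[lebesgue_measure]_(t in `[0%R, n.+1%:R]) (f s t)%:E =
  (- f s n.+1%:R)%:E +
  s%:E * \int[lebesgue_measure]_(t in `[0%R, n.+1%:R]) (f (s - 1) t)%:E)%E.
Proof.
have s0 : 0 < s by rewrite (lt_le_trans _ s1).
have n0 : 0 < n.+1%:R :> R by rewrite ltr0n.
have dexp (x : R) : is_derive x 1 (fun t => - expR (- t)) (expR (- x)).
  by apply: is_derive_eq; rewrite /GRing.scale/=; ring.
have cexp (x : R) : {for x, continuous (fun t => - expR (- t))}.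
  exact/differentiable_continuous/derivable1_diffP/ex_derive.
have cexp' (x : R) : {for x, continuous (fun t => expR (- t))}.
  by apply: continuous_comp; [exact: opp_continuous|exact: continuous_expR].
rewrite (@integration_by_parts R (fun t => t `^ s) (fun t => - expR (- t))
  (fun t => s * t `^ (s - 1)) (fun t => expR (- t)))//.
- rewrite powR0 ?gt_eqF// mul0r subr0 mulrN; congr (_ + _)%E.
  under eq_integral do rewrite mulrN -mulrA EFinN EFinM.
  rewrite integral_ge0N; last first.
    by move=> x _; rewrite -EFinM lee_fin mulr_ge0 ?(ltW s0)//; exact: f_ge0.
  rewrite oppeK ge0_integralZl//.
  + by apply/measurable_EFinP; apply: measurable_funTS; exact: mf.
  + by move=> x _; rewrite lee_fin; exact: f_ge0.
  + by rewrite lee_fin ltW.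
- have s10 : 0 <= s - 1 by rewrite subr_ge0.
  have /subspace_continuousP cp := continuous_powR s10 n0.
  apply/subspace_continuousP => x xn; apply: cvgM; first exact: cvg_cst.
  exact: cp.
- have cp := @continuous_powR s n.+1%:R (ltW s0) n0.
  move/(continuous_within_itvP _ n0) : cp => [_ c0 cn]; split => // x.
  by rewrite in_itv/= => /andP[x0 _]; apply: derivable_powR; rewrite in_itv/= x0.
- move=> x; rewrite in_itv/= => /andP[x0 _].
  have dx := is_derive1_powR s x0.
  by rewrite derive1E (@derive_val _ _ _ _ _ _ _ dx).
- by apply: continuous_subspaceT => x; exact: cexp'.
- split=> [x _| |]; first exact: ex_derive.
  + by apply: cvg_at_right_filter; exact: cexp.
  + by apply: cvg_at_left_filter; exact: cexp.
- by move=> x _; rewrite derive1E (@derive_val _ _ _ _ _ _ _ (dexp x)).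
Qed.

(** Integration by parts on [0, N + 1], then N to infinity. The bound 1 <= s makes t^(s-1)
    continuous up to 0, so the closed interval can be used. *)
Lemma GammaS : Gamma (s + 1) = s * Gamma s.
Proof.
have s0 : 0 < s by rewrite (lt_le_trans _ s1).
have GE a : (\int[lebesgue_measure]_(t in `]0%R, +oo[) (f a t)%:E =
    \int[lebesgue_measure]_(t in `[0%R, +oo[) (f a t)%:E)%E.
  rewrite -integral_itv_obnd_cbnd//.
  by apply/measurable_EFinP; apply: measurable_funTS; exact: mf.
rewrite /Gamma addrK.
rewrite /Rintegral (GE s) (GE (s - 1)).
set G := (\int[_]_(t in _) _)%E; set F := (X in s * fine X).
(* The identity is proved in the extended reals. Were [F] infinite, both real integrals would take
   the default value 0. *)
suff -> : G = (s%:E * F)%E.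
  have F0 : (0 <= F)%E by apply: integral_ge0 => t _; rewrite lee_fin.
  case: F F0 => [r| |]//= _.
  by rewrite gt0_muley ?lte_fin// mulr0.
have cG := @ge0_cvgn_integral R lebesgue_measure (f s) (f_ge0 s) (mf s).
have cF := @ge0_cvgn_integral R lebesgue_measure (f (s - 1)) (f_ge0 _) (mf _).
rewrite -cvg_shiftS /= in cG; rewrite -cvg_shiftS /= in cF.
apply: (cvg_unique _ cG) => //=.
rewrite -[X in _ --> X]add0e; under eq_cvg do rewrite parts.
apply: cvgeD => //; last exact: cvgeZl.
apply: cvg_EFin; first exact: nearW.
by rewrite -oppr0; exact: cvgN.
Qed.

End gamma_recursion.

(** * Bessel series as exponential integrals *)

Section bessel_moments.
Context {R : realType}.

Lemma norm_series_exp_coeff_le (x c : R) K : `|x| <= c ->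
  `|series (exp_coeff x) K| <= expR c.
Proof.
move=> xc; apply: (@le_trans _ _ (series (exp_coeff c) K)).
  rewrite !seriesEord (le_trans (ler_norm_sum _ _ _))// ler_sum// => i _.
  rewrite /exp_coeff /= normrM normfV normrX (@ger0_norm _ i`!%:R)// ler_wpM2r//.
  by rewrite lerXn2r// ?nnegrE// (le_trans _ xc).
have c0 : 0 <= c by rewrite (le_trans _ xc).
rewrite /expR; apply: nondecreasing_cvgn_le; last exact: is_cvg_series_exp_coeff.
apply: nondecreasing_series => i _ _; exact: exp_coeff_ge0.
Qed.

Variables (n : nat) (mu : n.-tuple R) (kappa : R).
Hypotheses (n2 : (2 <= n)%N) (mu1 : dotp mu mu = 1) (kappa0 : 0 < kappa).

Let n0 : (0 < n)%N. Proof. exact: leq_trans n2. Qed.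

Let w (x : n.-tuple R) := dotp mu (unit_vec x).

Let S : R := \sum_(i < n) `|tnth mu i|.

Let mw : measurable_fun setT w.
Proof. exact: (measurableT_comp (measurable_dotp mu) measurable_unit_vec). Qed.

Let w_le x : `|kappa * w x| <= kappa * S.
Proof.
rewrite normrM gtr0_norm// ler_wpM2l ?(ltW kappa0)//.
exact/dotp_cube_le/cube_unit_vec.
Qed.

(** Dominated convergence: all partial sums of the exponential series are bounded by
    [expR (kappa * S)]. *)
Lemma cvg_moment_series (g : n.-tuple R -> R) (C : R) :
  measurable_fun setT g -> (forall x, `|g x| <= C) ->
  (\sum_(k < K) kappa ^+ k / k`!%:R *
    \int[lebesgue_tuple n]_(x in punctured_ball n) (g x * w x ^+ k)) @[K --> \oo] -->
  \int[lebesgue_tuple n]_(x in punctured_ball n) (g x * expR (kappa * w x)).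
Proof.
move=> mg gC; have mB := @measurable_punctured_ball R n.
have mgw k : measurable_fun setT (fun x => g x * w x ^+ k).
  by apply: measurable_funM => //; exact: measurable_funX.
have igw k : (lebesgue_tuple n).-integrable (punctured_ball n)
    (EFin \o (fun x => g x * w x ^+ k)).
  apply: (@integrable_punctured_ball _ _ _ (C * S ^+ k)) => // x _.
  rewrite normrM normrX ler_pM// ?exprn_ge0// lerXn2r ?nnegrE ?sumr_ge0//.
  exact/dotp_cube_le/cube_unit_vec.
have E K : \sum_(k < K) kappa ^+ k / k`!%:R *
    \int[lebesgue_tuple n]_(x in punctured_ball n) (g x * w x ^+ k) =
  \int[lebesgue_tuple n]_(x in punctured_ball n)
    (g x * series (exp_coeff (kappa * w x)) K).
  transitivity (\sum_(k < K) \int[lebesgue_tuple n]_(x in punctured_ball n)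
      (kappa ^+ k / k`!%:R * (g x * w x ^+ k))).
    by apply: eq_bigr => k _; rewrite RintegralZl.
  rewrite -Rintegral_sum//; last by move=> k _; exact: integrableZl_EFin.
  apply: eq_Rintegral => x _; rewrite seriesEord mulr_sumr.
  by apply: eq_bigr => k _; rewrite /exp_coeff /= exprMn; ring.
under eq_cvg do rewrite E.
apply: (dominated_cvg_Rintegral mB (g := fun=> C * expR (kappa * S))).
- move=> K; apply: measurable_funTS; apply: measurable_funM => //.
  rewrite [X in measurable_fun _ X](_ : _ = fun x =>
      \sum_(i < K) exp_coeff (kappa * w x) i); last first.
    by apply/funext => x; rewrite seriesEord.
  apply: measurable_sum => i; apply: measurable_funM => //.
  by apply: measurable_funX; exact: measurable_funM.
- move=> x _; apply: cvgM; first exact: cvg_cst.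
  exact: is_cvg_series_exp_coeff.
- by apply: (@integrable_punctured_ball _ _ _ `|C * expR (kappa * S)|).
- by move=> K x _; rewrite normrM ler_pM//; exact: norm_series_exp_coeff_le.
Qed.

Let m := dir_moment mu.

Lemma dir_moment_odd j : m j.*2.+1 = 0.
Proof.
elim: j => [|j ih]; first exact: dir_moment1.
have /eqP := dir_momentSS n0 mu1 j.*2.+1; rewrite -/m ih mulr0 mulf_eq0.
by rewrite pnatr_eq0 addn_eq0 andbF/= => /eqP.
Qed.

(** The two-step recursion solved in closed form, matched with Gamma through 4 (j + 1) (n/2 + j) = 2
    (j + 1) (n + 2j). It is free of division because Gamma is not yet known to be nonzero. *)
Lemma dir_moment_even j :
  m j.*2 * (4 ^+ j * j`!%:R * Gamma (n%:R / 2 + j%:R)) =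
  (j.*2)`!%:R * (m 0 * Gamma (n%:R / 2)).
Proof.
elim: j => [|j ih]; first by rewrite expr0 fact0 addr0; ring.
have h1 : 1 <= n%:R / 2 + j%:R :> R.
  have : 2 <= n%:R :> R by rewrite ler_nat.
  have : 0 <= j%:R :> R by [].
  lra.
have hS : n%:R / 2 + j.+1%:R = n%:R / 2 + j%:R + 1 :> R by rewrite -addrA natr1.
rewrite doubleS !factS hS (GammaS h1).
have E := dir_momentSS n0 mu1 j.*2; rewrite -/m in E.
transitivity (2 * (j%:R + 1) * ((n + j.*2)%:R * m j.*2.+2) *
    (4 ^+ j * j`!%:R * Gamma (n%:R / 2 + j%:R))).
  rewrite exprS natrM natrD -muln2 natrM -[j.+1%:R]natr1. by field.
rewrite E -mulrA -[_ * m _ * _]mulrA ih !natrM.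
rewrite -[j.*2.+2%:R]natr1 -[j.*2.+1%:R]natr1 -muln2 natrM; ring.
Qed.

Lemma Gamma_nat_half_eq0 j : Gamma (n%:R / 2 : R) = 0 ->
  Gamma (n%:R / 2 + j%:R : R) = 0.
Proof.
move=> G0; elim: j => [|j ih]; first by rewrite addr0.
have h1 : 1 <= n%:R / 2 + j%:R :> R.
  have : 2 <= n%:R :> R by rewrite ler_nat.
  have : 0 <= j%:R :> R by [].
  lra.
by rewrite -[j.+1%:R]natr1 addrA (GammaS h1) ih mulr0.
Qed.

Definition exp_integral : R :=
  \int[lebesgue_tuple n]_(x in punctured_ball n) expR (kappa * w x).

(** Formally the derivative of [exp_integral] in kappa, which makes the Bessel ratio a logarithmic
    derivative. *)
Definition dexp_integral : R :=
  \int[lebesgue_tuple n]_(x in punctured_ball n) (w x * expR (kappa * w x)).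

(** Terms of one parity vanish in each exponential series, so K terms of a Bessel series correspond
    to 2K terms of the former. *)
Let bisect_sum (F : nat -> R) K :
  \sum_(k < K.*2) F k = \sum_(j < K) (F j.*2 + F j.*2.+1).
Proof.
elim: K => [|K ih]; first by rewrite !big_ord0.
by rewrite doubleS !big_ord_recr/= ih addrA.
Qed.

Let cvg_double (u : nat -> R) (l : R) : u K @[K --> \oo] --> l ->
  u K.*2 @[K --> \oo] --> l.
Proof.
apply: cvg_comp => A [N _ NA]; exists N => // k /= Nk; apply: NA => /=.
by rewrite (leq_trans Nk)// -addnn leq_addr.
Qed.

Let cvg_exp_integral :
  (\sum_(k < K) kappa ^+ k / k`!%:R * m k) @[K --> \oo] --> exp_integral.
Proof.
have n1 (x : n.-tuple R) : `|cst 1 x| <= 1 :> R by rewrite normr1.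
have h := cvg_moment_series (measurable_cst (1 : R)) n1.
rewrite /exp_integral (@eq_Rintegral _ _ _ _ _
  (fun x => cst 1 x * expR (kappa * w x))); last by move=> x _; rewrite mul1r.
rewrite (_ : (fun K => _) = (fun K => \sum_(k < K) kappa ^+ k / k`!%:R *
  \int[lebesgue_tuple n]_(x in punctured_ball n) (cst 1 x * w x ^+ k)))//.
apply/funext => K; apply: eq_bigr => k _; congr (_ * _).
by apply: eq_Rintegral => x _; rewrite mul1r.
Qed.

Let cvg_dexp_integral :
  (\sum_(k < K) kappa ^+ k / k`!%:R * m k.+1) @[K --> \oo] --> dexp_integral.
Proof.
have h := cvg_moment_series mw (fun x => dotp_cube_le mu (@cube_unit_vec R n x)).
rewrite (_ : (fun K => _) = (fun K => \sum_(k < K) kappa ^+ k / k`!%:R *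
  \int[lebesgue_tuple n]_(x in punctured_ball n) (w x * w x ^+ k)))//.
apply/funext => K; apply: eq_bigr => k _; congr (_ * _).
by apply: eq_Rintegral => x _; rewrite -exprS.
Qed.

(** The two moment series agree term by term by [coord_momentE], hence so do their limits. *)
Lemma coord_exp_integral i :
  \int[lebesgue_tuple n]_(x in punctured_ball n)
    (tnth (unit_vec x) i * expR (kappa * dotp mu (unit_vec x))) =
  tnth mu i * dexp_integral.
Proof.
have mc : measurable_fun setT (fun x : n.-tuple R => tnth (unit_vec x) i).
  exact: (measurableT_comp (measurable_tnth i) measurable_unit_vec).
have h1 := cvg_moment_series mc (fun x => @cube_unit_vec R n x i).
have h2 : tnth mu i * (\sum_(k < K) kappa ^+ k / k`!%:R * m k.+1) @[K --> \oo] -->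
    tnth mu i * dexp_integral.
  by apply: cvgM; [exact: cvg_cst|exact: cvg_dexp_integral].
apply: (cvg_unique _ h1); first exact: norm_hausdorff.
have -> : (fun K => \sum_(k < K) kappa ^+ k / k`!%:R *
    \int[lebesgue_tuple n]_(x in punctured_ball n) (tnth (unit_vec x) i * w x ^+ k)) =
  (fun K => tnth mu i * (\sum_(k < K) kappa ^+ k / k`!%:R * m k.+1)).
  apply/funext => K; rewrite mulr_sumr; apply: eq_bigr => k _.
  by rewrite -/(coord_moment mu i k) coord_momentE// mulrCA.
exact: h2.
Qed.

(** [q / P] will be the factor between Bessel values and exponential integrals; being common to both
    orders, it cancels in the ratio. *)
Let P : R := m 0 * Gamma (n%:R / 2).
Let q : R := (kappa / 2) `^ (n%:R / 2 - 1).

Let kappa2 : 0 < kappa / 2. Proof. by rewrite divr_gt0. Qed.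

Let powR_shift a j : (kappa / 2) `^ (a + 2 * j%:R) =
  (kappa / 2) `^ a * (kappa ^+ j.*2 / 4 ^+ j).
Proof.
rewrite powRD; last by rewrite (gt_eqF kappa2) implybT.
rewrite (_ : 2 * j%:R = j.*2%:R); last by rewrite -muln2 natrM mulrC.
rewrite powR_mulrn ?(ltW kappa2)// exprMn exprVn; congr (_ * (_ / _)).
by rewrite -mul2n exprM (_ : 2 ^+ 2 = 4 :> R)//; ring.
Qed.

Section nonzero.
Hypothesis P0 : P != 0.

Let G0 j : Gamma (n%:R / 2 + j%:R : R) != 0.
Proof.
apply/eqP => Gj; have /esym/eqP := dir_moment_even j.
rewrite Gj !mulr0 mulf_eq0 -/P (negbTE P0) orbF pnatr_eq0.
by rewrite -leqn0 leqNgt fact_gt0.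
Qed.

Let mE j : m j.*2 = (j.*2)`!%:R * P / (4 ^+ j * j`!%:R * Gamma (n%:R / 2 + j%:R)).
Proof.
have D0 : 4 ^+ j * j`!%:R * Gamma (n%:R / 2 + j%:R) != 0 :> R.
  by rewrite !mulf_neq0 ?G0 ?expf_neq0 ?pnatr_eq0// -lt0n fact_gt0.
by have := dir_moment_even j; rewrite -/P => <-; rewrite (mulfK D0).
Qed.

Lemma besselI_exp_integral : besselI (n%:R / 2 - 1) kappa = q / P * exp_integral.
Proof.
apply/cvg_lim => //.
have -> : series (fun k : nat => (kappa / 2) `^ (n%:R / 2 - 1 + 2 * k%:R) /
    (k`!%:R * Gamma (n%:R / 2 - 1 + k%:R + 1))) =
  (fun K => q / P * \sum_(k < K.*2) kappa ^+ k / k`!%:R * m k).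
  apply/funext => K; rewrite seriesEord.
  rewrite (bisect_sum (fun k => kappa ^+ k / k`!%:R * m k)) mulr_sumr.
  apply: eq_bigr => j _.
  rewrite dir_moment_odd mulr0 addr0 powR_shift -/q mE.
  have -> : n%:R / 2 - 1 + j%:R + 1 = n%:R / 2 + j%:R :> R by ring.
  have f1 k : k`!%:R != 0 :> R by rewrite pnatr_eq0 -lt0n fact_gt0.
  have := G0 j; have := f1 j; have := f1 j.*2;
    have : 4 ^+ j != 0 :> R by rewrite expf_neq0.
  move: (Gamma _) (j`!%:R : R) (j.*2`!%:R : R) (4 ^+ j : R) P P0 => a b c e p.
  by move=> p0 e0 c0 b0 a0; field; rewrite a0 b0 c0 e0 p0.
apply: cvgM; first exact: cvg_cst.
exact: (cvg_double cvg_exp_integral).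
Qed.

(** Only the odd indices 2j + 1 survive, with moment of order 2j + 2. There (2j + 2)! / ((2j + 1)! 4
    (j + 1)) = 1/2, which with the extra kappa makes up (kappa/2)^(n/2) = q kappa/2. *)
Lemma besselI_dexp_integral : besselI (n%:R / 2) kappa = q / P * dexp_integral.
Proof.
apply/cvg_lim => //.
have -> : series (fun k : nat => (kappa / 2) `^ (n%:R / 2 + 2 * k%:R) /
    (k`!%:R * Gamma (n%:R / 2 + k%:R + 1))) =
  (fun K => q / P * \sum_(k < K.*2) kappa ^+ k / k`!%:R * m k.+1).
  apply/funext => K; rewrite seriesEord.
  rewrite (bisect_sum (fun k => kappa ^+ k / k`!%:R * m k.+1)) mulr_sumr.
  apply: eq_bigr => j _.
  rewrite dir_moment_odd mulr0 add0r powR_shift.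
  have -> : (kappa / 2) `^ (n%:R / 2) = q * (kappa / 2).
    rewrite -[in LHS](subrK 1 (n%:R / 2)) powRD ?powRr1 ?(ltW kappa2)//.
    by rewrite (gt_eqF kappa2) implybT.
  have -> : n%:R / 2 + j%:R + 1 = n%:R / 2 + j.+1%:R :> R by rewrite -addrA natr1.
  rewrite -doubleS mE doubleS exprS [(j.*2.+2)`!]factS natrM.
  have -> : j.*2.+2%:R = 2 * j.+1%:R :> R by rewrite -doubleS -mul2n natrM.
  rewrite (factS j) natrM exprS.
  have f1 k : k`!%:R != 0 :> R by rewrite pnatr_eq0 -lt0n fact_gt0.
  have j0 : j.+1%:R != 0 :> R by rewrite pnatr_eq0.
  have := G0 j.+1; have := f1 j; have := f1 j.*2.+1;
    have : 4 ^+ j != 0 :> R by rewrite expf_neq0.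
  move: j0; move: (j.+1%:R : R) => r r0.
  move: (Gamma _) (j`!%:R : R) (j.*2.+1`!%:R : R) (4 ^+ j : R) P P0 => a b c e p.
  by move=> p0 e0 c0 b0 a0; field; rewrite a0 b0 c0 e0 p0 r0.
apply: cvgM; first exact: cvg_cst.
exact: (cvg_double cvg_dexp_integral).
Qed.

Lemma bessel_ratioE : bessel_ratio n kappa = dexp_integral / exp_integral.
Proof.
rewrite /bessel_ratio besselI_dexp_integral besselI_exp_integral.
have q0 : q != 0 by rewrite gt_eqF// powR_gt0.
have qP : q / P != 0 by rewrite mulf_neq0// invr_eq0.
by rewrite -mulf_div divff// mul1r.
Qed.

End nonzero.

(** [m 0] is the volume of the punctured ball, and a bounded integrand over a null set integrates to
    0. *)
Lemma exp_integral_neq0 : exp_integral != 0 -> m 0 != 0.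
Proof.
have mB := @measurable_punctured_ball R n.
apply: contra => /eqP m0.
have e0 : 0 <= exp_integral by apply: Rintegral_ge0 => x _; exact: expR_ge0.
have le_exp x : expR (kappa * w x) <= expR (kappa * S).
  by rewrite ler_expR (le_trans (ler_norm _)).
rewrite eq_le e0 andbT.
apply: (@le_trans _ _ (\int[lebesgue_tuple n]_(x in punctured_ball n)
    (expR (kappa * S) * w x ^+ 0))).
  apply: le_Rintegral => //.
  - apply: (@integrable_punctured_ball _ _ _ (expR (kappa * S))).
      by apply: measurableT_comp => //; exact: measurable_funM.
    by move=> x _; rewrite ger0_norm ?expR_ge0.
  - apply: (@integrable_punctured_ball _ _ _ (expR (kappa * S))).
      by apply: measurable_funM => //; exact: measurable_funX.
    by move=> x _; rewrite expr0 mulr1 ger0_norm ?expR_ge0.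
  - by move=> x _; rewrite expr0 mulr1.
rewrite RintegralZl//; last first.
  apply: (@integrable_punctured_ball _ _ _ 1); first exact: measurable_funX.
  by move=> x _; rewrite expr0 normr1.
by rewrite -/(dir_moment mu 0) -/m m0 mulr0.
Qed.

(* If Gamma (n/2) were 0, all denominators in the Bessel series would vanish,
   and with x / 0 = 0 so would the series. *)
Lemma Gamma_half_neq0 : besselI (n%:R / 2 - 1) kappa != 0 -> Gamma (n%:R / 2 : R) != 0.
Proof.
apply: contra => /eqP G0; apply/eqP; apply/cvg_lim => //.
rewrite [X in X @ _ --> _](_ : _ = cst 0); first exact: cvg_cst.
apply/funext => K; rewrite seriesEord /= big1// => j _.
rewrite (_ : n%:R / 2 - 1 + j%:R + 1 = n%:R / 2 + j%:R); last by ring.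
by rewrite Gamma_nat_half_eq0// mulr0 invr0 mulr0.
Qed.

End bessel_moments.

(** * Surface integrals and the FvML law as ball integrals *)

Section sphere_integral.
Context {R : realType} (n : nat).

Lemma measurable_unit_sphere : measurable (@unit_sphere R n).
Proof.
rewrite (_ : unit_sphere n = norm2 @^-1` [set 1])//.
by rewrite -[X in measurable X]setTI; exact: measurable_norm2.
Qed.

Lemma measurable_cone (B : set (n.-tuple R)) : measurable B ->
  measurable (punctured_ball n `&` unit_vec @^-1` B).
Proof.
move=> mB; apply: measurableI; first exact: measurable_punctured_ball.
by rewrite -[X in measurable X]setTI; exact: measurable_unit_vec.
Qed.

Lemma cone_lty (B : set (n.-tuple R)) : measurable B ->
  (lebesgue_tuple n (punctured_ball n `&` unit_vec @^-1` B) < +oo)%E.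
Proof.
move=> mB; apply: le_lt_trans (punctured_ball_lty n).
apply: le_measure; [apply/mem_set..|] => //.
- exact: measurable_cone.
- exact: measurable_punctured_ball.
Qed.

Lemma sphere_measure_lty (B : set (n.-tuple R)) : measurable B ->
  (sphere_measure B < +oo)%E.
Proof. by move=> mB; rewrite lte_mul_pinfty// cone_lty. Qed.

Lemma sphere_measure_off_sphere :
  sphere_measure (~` unit_sphere n : set (n.-tuple R)) = 0%E.
Proof.
rewrite /sphere_measure (_ : _ `&` _ = set0) ?measure0 ?mule0//.
apply/seteqP; split => x //= -[/andP[x0 _]]; apply.
exact: norm2_unit_vec.
Qed.

(** On indicators this is the construction of the surface measure; [transfer] compares the identity
    with weight 1 to [unit_vec] with weight n. *)
Lemma integral_sphere_measure (g : n.-tuple R -> R) (C : R) :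
  measurable_fun setT g -> (forall x, `|g x| <= C) ->
  \int[@sphere_measure R n]_x g x =
  n%:R * \int[lebesgue_tuple n]_(x in punctured_ball n) g (unit_vec x).
Proof.
move=> mg gC; have mB := @measurable_punctured_ball R n.
have mu := @measurable_unit_vec R n.
have ic1 : (@sphere_measure R n).-integrable setT (EFin \o (fun=> 1 : R)).
  apply: (bounded_integrable measurableT (C := 1)) => //.
    exact: sphere_measure_lty.
  by move=> x _; rewrite normr1.
have icn : (lebesgue_tuple n).-integrable (@punctured_ball R n)
    (EFin \o (fun=> n%:R : R)).
  by apply: (@integrable_punctured_ball _ _ _ `|n%:R|).
have h : forall B, measurable B ->
    \int[@sphere_measure R n]_(x in setT) (\1_B (id x) * 1) =
    \int[lebesgue_tuple n]_(x in punctured_ball n) (\1_B (unit_vec x) * n%:R).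
  move=> B mBB; under eq_Rintegral do rewrite mulr1.
  rewrite [RHS]RintegralZr//; last first.
    apply: (@integrable_punctured_ball _ _ _ 1).
      exact: (measurableT_comp (measurable_indic mBB) mu).
    by move=> x _; rewrite indicE; case: (_ \in _); rewrite ?normr0 ?normr1.
  rewrite /Rintegral integral_indic// setIT /=.
  have -> : (fun x => (\1_B (unit_vec x))%:E) =
      (fun x => (\1_(unit_vec @^-1` B) x)%:E) :> (n.-tuple R -> \bar R).
    by [].
  rewrite integral_indic//; last first.
    by rewrite -[X in measurable X]setTI; exact: mu.
  have fL : lebesgue_tuple n (punctured_ball n `&` unit_vec @^-1` B) \is a fin_num.
    by rewrite ge0_fin_numE//; exact: cone_lty.
  rewrite setIC [RHS]mulrC; exact: (fineM (isT : (n%:R)%:E \is a fin_num) fL).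
have := transfer measurableT mB (@measurable_id _ _ _) mu ic1 icn h mg gC.
under eq_Rintegral do rewrite mulr1.
move=> ->; rewrite RintegralZr 1?mulrC//.
apply: (@integrable_punctured_ball _ _ _ C) => //.
exact: (measurableT_comp mg mu).
Qed.

(** On the sphere, hence almost everywhere, the density equals its composition with [unit_vec],
    which is bounded on the whole space as [integral_sphere_measure] requires. *)
Lemma FvMLE (mu : n.-tuple R) (kappa : R) (A : set (n.-tuple R)) :
  measurable A ->
  FvML mu kappa A = (n%:R * FvML_const n kappa *
    \int[lebesgue_tuple n]_(x in punctured_ball n)
      (\1_A (unit_vec x) * expR (kappa * dotp mu (unit_vec x))))%:E.
Proof.
move=> mA; have mB := @measurable_punctured_ball R n.
set C := FvML_const n kappa.
set S : R := \sum_(i < n) `|tnth mu i|.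
pose w (x : n.-tuple R) := dotp mu (unit_vec x).
have mw : measurable_fun setT w.
  exact: (measurableT_comp (measurable_dotp mu) measurable_unit_vec).
have mexp : measurable_fun setT (fun x => expR (kappa * w x)).
  by apply: measurableT_comp => //; exact: measurable_funM.
have exp_le x : `|expR (kappa * w x)| <= expR (`|kappa| * S).
  rewrite ger0_norm ?expR_ge0// ler_expR (le_trans (ler_norm _))// normrM.
  by rewrite ler_wpM2l//; exact/dotp_cube_le/cube_unit_vec.
have Cexp_le x : `|C * expR (kappa * w x)| <= `|C| * expR (`|kappa| * S).
  by rewrite normrM ler_wpM2l.
have mCexp : measurable_fun setT (fun x => C * expR (kappa * w x)).
  exact: measurable_funM.
rewrite /FvML.
have -> : (\int[@sphere_measure R n]_(x in A) (FvML_pdf mu kappa x)%:E =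
    \int[@sphere_measure R n]_(x in A) (C * expR (kappa * w x))%:E)%E.
  apply: ae_eq_integral => //.
  - apply/measurable_EFinP; apply: measurable_funTS.
    apply: measurable_funM => //; apply: measurableT_comp => //.
    by apply: measurable_funM => //; exact: measurable_dotp.
  - by apply/measurable_EFinP; exact: measurable_funTS.
  - exists (~` unit_sphere n); split.
    + by apply: measurableC; exact: measurable_unit_sphere.
    + exact: sphere_measure_off_sphere.
    + move=> x /= /not_implyP[_]; apply: contra_not => x1.
      by rewrite /FvML_pdf /w unit_vec_sphere.
have iC : (@sphere_measure R n).-integrable A
    (EFin \o (fun x => C * expR (kappa * w x))).
  apply: (bounded_integrable mA _ _ (fun x _ => Cexp_le x)).
    exact: sphere_measure_lty.
  exact: measurable_funTS.
rewrite -[LHS]fineK; last exact: integrable_fin_num.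
congr EFin; rewrite -/(Rintegral _ _ _) Rintegral_mkcond.
pose g x := \1_A x * (C * expR (kappa * w x)).
rewrite (_ : _ \_ A = g); last first.
  apply/funext => x; rewrite /g patchE indicE.
  by case: (x \in A); rewrite ?mul1r ?mul0r.
have mg : measurable_fun setT g by apply: measurable_funM.
rewrite (integral_sphere_measure (C := `|C| * expR (`|kappa| * S)) mg).
  have iE : (lebesgue_tuple n).-integrable (punctured_ball n)
      (EFin \o (fun x => \1_A (unit_vec x) * expR (kappa * w x))).
    apply: (@integrable_punctured_ball _ _ _ (expR (`|kappa| * S))).
      apply: measurable_funM => //.
      exact: (measurableT_comp (measurable_indic mA) measurable_unit_vec).
    move=> x _; rewrite normrM -[leRHS]mul1r ler_pM//.
    by rewrite indicE; case: (_ \in _); rewrite ?normr0 ?normr1.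
  rewrite -mulrA -(@RintegralZl _ _ _ (lebesgue_tuple n) _ _ C mB iE).
  congr (_ * _); apply: eq_Rintegral => x /set_mem /andP[x0 _].
  rewrite /g /w (unit_vec_sphere (norm2_unit_vec x0)).
  by rewrite mulrCA.
move=> x; rewrite normrM -[leRHS]mul1r ler_pM//.
by rewrite indicE; case: (_ \in _); rewrite ?normr0 ?normr1.
Qed.

End sphere_integral.

(** * Mean of an FvML vector *)

Section FvML_law.
Context {R : realType} (n : nat) (mu : n.-tuple R) (kappa : R).
Hypotheses (n2 : (2 <= n)%N) (mu1 : unit_sphere n mu) (kappa0 : 0 < kappa).
Context d (Omega : measurableType d) (P : probability Omega R)
  (X : {RV P >-> n.-tuple R}).
Hypothesis X_dist : forall A : set (n.-tuple R), measurable A ->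
  distribution P X A = FvML mu kappa A.

Let w (x : n.-tuple R) := dotp mu (unit_vec x).

Let dotp_mu : dotp mu mu = 1.
Proof. by rewrite -norm2_sqr mu1 expr1n. Qed.

(** In [FvMLE] for the complement of the sphere, the indicator is evaluated at normalized vectors
    and so is 0. *)
Lemma FvML_ae_sphere : {ae P, forall o, unit_sphere n (X o)}.
Proof.
have mS := @measurable_unit_sphere R n.
exists (X @^-1` (~` unit_sphere n)); split => //.
- by apply: measurable_funPTI; exact: measurableC.
- have := X_dist (measurableC mS); rewrite FvMLE; last exact: measurableC.
  rewrite /distribution /pushforward /= => ->.
  rewrite (_ : Rintegral _ _ _ = 0) ?mulr0//.
  rewrite -[RHS](@Rintegral_set0 _ _ _ (lebesgue_tuple n) (cst 0)).
  rewrite [RHS]Rintegral_mkcond [LHS]Rintegral_mkcond; apply: eq_Rintegral => x _.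
  rewrite !patchE; case: ifPn => xB; last by rewrite in_set0.
  rewrite in_set0 indicE memNset ?mul0r//= ; apply; apply: norm2_unit_vec.
  by move/set_mem : xB => /andP[].
Qed.

(** The total mass is 1 because a random variable has this law. This equation is the source of every
    nonvanishing fact below. *)
Lemma FvML_normalization :
  n%:R * FvML_const n kappa * exp_integral mu kappa = 1.
Proof.
have := X_dist measurableT; rewrite FvMLE// /distribution /pushforward /=.
rewrite preimage_setT probability_setT => -[] E; rewrite [RHS]E; congr (_ * _).
by rewrite /exp_integral; apply: eq_Rintegral => x _; rewrite indicT mul1r.
Qed.

(** The mean is [c] times mu_i times [dexp_integral], and the normalization makes [c] the inverse of
    [exp_integral]; what remains is the Bessel ratio. *)
Lemma FvML_coord_mean i :
  \int[P]_o tnth (unit_vec (X o)) i = tnth mu i * bessel_ratio n kappa.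
Proof.
have mB := @measurable_punctured_ball R n.
set c := n%:R * FvML_const n kappa.
have cZ : c * exp_integral mu kappa = 1 := FvML_normalization.
have ZN0 : exp_integral mu kappa != 0.
  by apply/eqP => Z0; move/eqP : cZ; rewrite Z0 mulr0 eq_sym oner_eq0.
have m0 : dir_moment mu 0 != 0 by exact: exp_integral_neq0 ZN0.
(* A vanishing Bessel value would make [FvML_const] equal to 0, as x / 0 = 0, against the
   normalization. *)
have G0 : Gamma (n%:R / 2 : R) != 0.
  apply: (Gamma_half_neq0 n2 (kappa := kappa)).
  apply/eqP => I0; move/eqP : cZ.
  by rewrite /c /FvML_const I0 mulr0 invr0 !mulr0 mul0r eq_sym oner_eq0.
have PN0 := mulf_neq0 m0 G0.
rewrite (bessel_ratioE n2 dotp_mu kappa0 PN0).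
have mw : measurable_fun setT w.
  exact: (measurableT_comp (measurable_dotp mu) measurable_unit_vec).
have mc : measurable_fun setT (fun x : n.-tuple R => tnth (unit_vec x) i).
  exact: (measurableT_comp (measurable_tnth i) measurable_unit_vec).
have iV : (lebesgue_tuple n).-integrable (punctured_ball n)
    (EFin \o (fun x => c * expR (kappa * w x))).
  apply: (@integrable_punctured_ball _ _ _
    (`|c| * expR (kappa * \sum_(j < n) `|tnth mu j|))).
    apply: measurable_funM => //; apply: measurableT_comp => //.
    exact: measurable_funM.
  move=> x _; rewrite normrM ler_wpM2l// ger0_norm ?expR_ge0// ler_expR.
  rewrite ler_pM2l// (le_trans (ler_norm _))//.
  exact/dotp_cube_le/cube_unit_vec.
have i1 : P.-integrable setT (EFin \o (fun=> 1 : R)).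
  apply: (bounded_integrable measurableT (C := 1)) => //.
    by rewrite -ge0_fin_numE// fin_num_measure.
  by move=> x _; rewrite normr1.
have iexp (g : n.-tuple R -> R) : measurable_fun setT g -> (forall x, `|g x| <= 1) ->
    (lebesgue_tuple n).-integrable (punctured_ball n)
    (EFin \o (fun x => g x * expR (kappa * w x))).
  move=> mg g1; apply: (@integrable_punctured_ball _ _ _
    (expR (kappa * \sum_(j < n) `|tnth mu j|))).
    apply: measurable_funM => //; apply: measurableT_comp => //.
    exact: measurable_funM.
  move=> x _; rewrite normrM -[leRHS]mul1r ler_pM//.
  rewrite ger0_norm ?expR_ge0// ler_expR.
  rewrite ler_pM2l// (le_trans (ler_norm _))//.
  exact/dotp_cube_le/cube_unit_vec.
have h : forall B, measurable B -> \int[P]_(o in setT) (\1_B (X o) * 1) =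
    \int[lebesgue_tuple n]_(x in punctured_ball n)
      (\1_B (unit_vec x) * (c * expR (kappa * w x))).
  move=> B mBB; under eq_Rintegral do rewrite mulr1.
  have iB := iexp (\1_B \o unit_vec)
    (measurableT_comp (measurable_indic mBB) measurable_unit_vec).
  have {}iB : (lebesgue_tuple n).-integrable (punctured_ball n)
    (EFin \o (fun x => \1_B (unit_vec x) * expR (kappa * w x))).
    by apply: iB => x /=; rewrite indicE; case: (_ \in _); rewrite ?normr0 ?normr1.
  have -> : \int[lebesgue_tuple n]_(x in punctured_ball n)
      (\1_B (unit_vec x) * (c * expR (kappa * w x))) =
    \int[lebesgue_tuple n]_(x in punctured_ball n)
      (c * (\1_B (unit_vec x) * expR (kappa * w x))).
    by apply: eq_Rintegral => x _; rewrite mulrCA.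
  rewrite (@RintegralZl _ _ _ (lebesgue_tuple n) _ _ c mB iB).
  have mXB : measurable (X @^-1` B) by exact: measurable_funPTI.
  rewrite /Rintegral (_ : (fun o => (\1_B (X o))%:E) =
    (fun o => (\1_(X @^-1` B) o)%:E) :> (Omega -> \bar R))//.
  rewrite integral_indic// setIT.
  by have := X_dist mBB; rewrite FvMLE// /distribution /pushforward /= => ->.
have mX : measurable_fun setT X by [].
have := transfer measurableT mB mX measurable_unit_vec i1 iV h mc
  (fun x => @cube_unit_vec R n x i).
under eq_Rintegral do rewrite mulr1.
move=> ->.
have ic := iexp _ mc (fun x => @cube_unit_vec R n x i).
transitivity (\int[lebesgue_tuple n]_(x in punctured_ball n)
    (c * (tnth (unit_vec x) i * expR (kappa * w x)))).
  apply: eq_Rintegral => x /set_mem /andP[x0 _].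
  by rewrite (unit_vec_sphere (norm2_unit_vec x0)) mulrCA.
rewrite (@RintegralZl _ _ _ (lebesgue_tuple n) _ _ c mB ic) coord_exp_integral//.
rewrite mulrCA; congr (_ * _); apply: (mulIf ZN0).
by rewrite divfK// mulrAC cZ mul1r.
Qed.

End FvML_law.

(** * Expectation of products of independent factors *)

Section independence.
Context d d' (Omega : measurableType d) (T : measurableType d') (R : realType)
  (P : probability Omega R) (I : finType) (X : I -> {RV P >-> T}).
Hypothesis X_indep : mutually_independent X.

Let mX i : measurable_fun setT (X i). Proof. by []. Qed.

Let prod_le1 (J : {set I}) (a : I -> R) : (forall i, `|a i| <= 1) ->
  `|\prod_(i in J) a i| <= 1.
Proof.
move=> a1; rewrite normr_prod; apply: prodr_ile1 => i _.
by rewrite a1 normr_ge0.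
Qed.

Lemma integrable_probability (f : Omega -> R) (C : R) : measurable_fun setT f ->
  (forall o, `|f o| <= C) -> P.-integrable setT (EFin \o f).
Proof.
move=> mf fC; apply: (bounded_integrable measurableT (C := C)) => //.
by rewrite -ge0_fin_numE// fin_num_measure.
Qed.

Let measurable_prodX (J : {set I}) (g : I -> T -> R) :
  (forall i, measurable_fun setT (g i)) ->
  measurable_fun setT (fun o => \prod_(i in J) g i (X i o)).
Proof.
move=> mg.
rewrite (_ : (fun o => _) = fun o => \prod_(i <- enum J) g i (X i o)); last first.
  by apply/funext => o; rewrite big_enum.
by apply: measurable_prod => i _; exact: measurableT_comp.
Qed.

Let prod_indicators (B : I -> set T) (J : {set I}) :
  (forall i, measurable (B i)) ->
  \int[P]_o \prod_(i in J) \1_(B i) (X i o) =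
  \prod_(i in J) \int[P]_o \1_(B i) (X i o) :> R.
Proof.
move=> mB.
have mXB i : measurable (X i @^-1` B i) by exact: measurable_funPTI.
have IE (A : set Omega) : measurable A -> \int[P]_o (\1_A o : R) = fine (P A).
  by move=> mA; rewrite /Rintegral integral_indic// setIT.
have -> : \int[P]_o \prod_(i in J) \1_(B i) (X i o) =
    \int[P]_o (\1_(\bigcap_(i in [set` J]) (X i @^-1` B i)) o : R).
  apply: eq_Rintegral => o _; rewrite indicE.
  have [oB|oB] := pselect ((\bigcap_(i in [set` J]) (X i @^-1` B i)) o).
    rewrite mem_set// big1// => i iJ; rewrite indicE mem_set//.
    exact: oB.
  rewrite memNset//.
  have [i [iJ /= Bi]] : exists i, i \in J /\ ~ B i (X i o).
    apply: contrapT => h; apply: oB => i /= iJ; apply: contrapT => Bi.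
    by apply: h; exists i.
  by rewrite (bigD1 i)//= indicE memNset// mul0r.
rewrite IE; last by apply: fin_bigcap_measurable => //; exact: finite_finset.
rewrite X_indep//.
have fE i : P (X i @^-1` B i) = (\int[P]_o \1_(B i) (X i o))%:E.
  by rewrite -[LHS]fineK ?fin_num_measure// -IE.
rewrite [X in fine X](_ : _ = \prod_(i in J) (\int[P]_o \1_(B i) (X i o))%:E)%E.
  by rewrite prodEFin.
by apply: eq_bigr => i _; exact: fE.
Qed.

(* The factors are turned from indicators into bounded functions one at a time;
   [s] lists the indices already converted. *)
Let prod_hybrid (s : seq I) (g : I -> T -> R) (B : I -> set T) (J : {set I}) :
  (forall i, measurable_fun setT (g i)) -> (forall i x, `|g i x| <= 1) ->
  (forall i, measurable (B i)) -> (forall i, i \notin s -> g i = \1_(B i)) ->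
  \int[P]_o \prod_(i in J) g i (X i o) = \prod_(i in J) \int[P]_o g i (X i o).
Proof.
elim: s g B J => [|a s ih] g B J mg g1 mB gB.
  have gE i : g i = \1_(B i) by apply: gB.
  transitivity (\int[P]_o \prod_(i in J) \1_(B i) (X i o) : R).
    by apply: eq_Rintegral => o _; apply: eq_bigr => i _; rewrite gE.
  rewrite prod_indicators//; apply: eq_bigr => i _.
  by apply: eq_Rintegral => o _; rewrite gE.
have step (A : set T) (K : {set I}) : measurable A ->
    let g' i := if i == a then \1_A else g i in
    \int[P]_o \prod_(i in K) g' i (X i o) = \prod_(i in K) \int[P]_o g' i (X i o).
  move=> mA g'; apply: (ih g' (fun i => if i == a then A else B i)) => i.
  - by rewrite /g'; case: eqP.
  - move=> x; rewrite /g'; case: eqP => // _.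
    by rewrite indicE; case: (_ \in _); rewrite ?normr0 ?normr1.
  - by case: eqP.
  - rewrite /g'; case: eqP => // /eqP ia is'.
    by apply: gB; rewrite in_cons negb_or ia.
have other (A : set T) (K : {set I}) : a \notin K ->
    (forall i, i \in K -> (if i == a then \1_A else g i) = g i).
  by move=> aK i iK; case: eqP => // ia; rewrite -ia iK in aK.
(* When [a] is outside [K], its factor does not occur and may be replaced by an indicator, which
   brings the product under the induction hypothesis. *)
have out (K : {set I}) : a \notin K ->
    \int[P]_o \prod_(i in K) g i (X i o) = \prod_(i in K) \int[P]_o g i (X i o).
  move=> aK; have := step setT K measurableT => /= E.
  transitivity (\int[P]_o \prod_(i in K) (if i == a then \1_setT else g i) (X i o)).
    by apply: eq_Rintegral => o _; apply: eq_bigr => i iK; rewrite (other _ _ aK).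
  rewrite E; apply: eq_bigr => i iK.
  by apply: eq_Rintegral => o _; rewrite (other _ _ aK).
have [aJ|] := boolP (a \in J); last exact: out.
pose K := J :\ a.
have aK : a \notin K by rewrite !inE eqxx.
pose W o := \prod_(i in K) g i (X i o).
have bigJ (F : I -> R) : \prod_(i in J) F i = F a * \prod_(i in K) F i.
  by rewrite (big_setD1 a).
have iW : P.-integrable setT (EFin \o W).
  apply: (integrable_probability (C := 1)) => [|o]; last exact: prod_le1.
  exact: measurable_prodX.
have iV : P.-integrable setT (EFin \o (fun=> \int[P]_o W o)).
  by apply: (integrable_probability (C := `|\int[P]_o W o|)).
(* With an indicator at [a], the induction hypothesis factors the expectation; [transfer], with
   weights [W] and the constant mean of [W], then replaces this indicator by [g a]. *)
have h A : measurable A ->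
    \int[P]_(o in setT) (\1_A (X a o) * W o) =
    \int[P]_(o in setT) (\1_A (X a o) * \int[P]_o W o).
  move=> mA; rewrite [RHS]RintegralZr//; last first.
    apply: (integrable_probability (C := 1)).
      by apply: (measurableT_comp (measurable_indic mA)).
    by move=> o; rewrite indicE; case: (_ \in _); rewrite ?normr0 ?normr1.
  have := step A J mA => /=.
  under eq_Rintegral do rewrite bigJ eqxx.
  rewrite bigJ eqxx => E.
  transitivity (\int[P]_o (\1_A (X a o) *
      \prod_(i in K) (if i == a then \1_A else g i) (X i o))).
    apply: eq_Rintegral => o _; congr (_ * _); apply: eq_bigr => i iK.
    by rewrite (other _ _ aK).
  rewrite E; congr (_ * _); rewrite out//; apply: eq_bigr => i iK.
  by apply: eq_Rintegral => o _; rewrite (other _ _ aK).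
under eq_Rintegral do rewrite bigJ -/(W _).
rewrite (transfer measurableT measurableT (@mX a) (@mX a) iW iV h (mg a) (g1 a)).
rewrite RintegralZr//; first by rewrite bigJ /W out.
apply: (integrable_probability (C := 1)) => //.
exact: (measurableT_comp (mg a)).
Qed.

Lemma independent_prod_Rintegral (g : I -> T -> R) (J : {set I}) :
  (forall i, measurable_fun setT (g i)) -> (forall i x, `|g i x| <= 1) ->
  \int[P]_o \prod_(i in J) g i (X i o) = \prod_(i in J) \int[P]_o g i (X i o).
Proof.
move=> mg g1; apply: (prod_hybrid (s := enum I) (B := fun=> setT)) => //.
by move=> i; rewrite mem_enum.
Qed.

End independence.

(** * Products over paired indices *)

Lemma big_pairs (R : comRingType) l (H : 'I_(2 * l) -> R) :
  \prod_(m < 2 * l) H m =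
  \prod_(k < l) (H (Ordinal (even_index_lt k)) * H (Ordinal (odd_index_lt k))).
Proof.
(* [H] is extended to all naturals so that the induction on [l] is free of the bound in the ordinal
   type. *)
pose h m := if insub m is Some o then H o else 1.
have hE m (m_lt : (m < 2 * l)%N) : h m = H (Ordinal m_lt).
  by rewrite /h insubT.
transitivity (\prod_(m < 2 * l) h m).
  by apply: eq_bigr => -[m m_lt] _; rewrite hE.
transitivity (\prod_(k < l) (h (2 * k)%N * h (2 * k + 1)%N)).
  move: h {hE} => h; elim: l {H} => [|l ih]; first by rewrite muln0 !big_ord0.
  by rewrite mulnS add2n !big_ord_recr/= ih addn1 mulrA.
by apply: eq_bigr => k _; rewrite (hE _ (even_index_lt k)) (hE _ (odd_index_lt k)).
Qed.

Section pair_products.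
Context d d' (Omega : measurableType d) (T : measurableType d') (R : realType)
  (P : probability Omega R) (N l : nat) (X : 'I_N -> {RV P >-> T}).
Hypothesis X_indep : mutually_independent X.

(** As [t] has distinct entries, each variable occurs in exactly one factor. The map [f] is the
    choice of a coordinate for each pair when the inner products are expanded. *)
Lemma independent_pairs (J : Type) (c : J -> T -> R) (f : 'I_l -> J)
    (t : (2 * l).-tuple 'I_N) : (0 < l)%N -> uniq t ->
  (forall j, measurable_fun setT (c j)) -> (forall j x, `|c j x| <= 1) ->
  \int[P]_o \prod_(k < l)
     (c (f k) (X (tnth t (Ordinal (even_index_lt k))) o) *
      c (f k) (X (tnth t (Ordinal (odd_index_lt k))) o)) =
  \prod_(k < l)
     ((\int[P]_o c (f k) (X (tnth t (Ordinal (even_index_lt k))) o)) *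
      (\int[P]_o c (f k) (X (tnth t (Ordinal (odd_index_lt k))) o))).
Proof.
move=> l0 t_uniq mc c1.
pose k0 : 'I_l := Ordinal l0.
(* Positions 2k and 2k + 1 both halve to k, the number of the pair. The default [k0] is met only off
   [t], outside the product considered. *)
pose g i := c (f (insubd k0 (index i t)./2)).
have index_t m : index (tnth t m) t = m.
  by rewrite (tnth_nth (tnth t m)) index_uniq// size_tuple.
have gE0 (k : 'I_l) : g (tnth t (Ordinal (even_index_lt k))) = c (f k).
  by rewrite /g index_t /= mul2n doubleK valKd.
have gE1 (k : 'I_l) : g (tnth t (Ordinal (odd_index_lt k))) = c (f k).
  by rewrite /g index_t /= mul2n addn1 /= uphalf_double valKd.
have bigJ (F : 'I_N -> R) : \prod_(i in [set i in t]) F i =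
    \prod_(k < l) (F (tnth t (Ordinal (even_index_lt k))) *
                   F (tnth t (Ordinal (odd_index_lt k)))).
  rewrite -(big_pairs (fun m => F (tnth t m))).
  transitivity (\prod_(i <- t) F i); last by rewrite big_tuple.
  by rewrite [RHS]big_uniq//; apply: eq_bigl => i; rewrite inE.
have := independent_prod_Rintegral X_indep (g := g) [set i in t]
  (fun i => mc _) (fun i => c1 _).
rewrite bigJ; under eq_Rintegral do rewrite bigJ.
under eq_Rintegral do under eq_bigr do rewrite gE0 gE1.
by under [in X in _ = X -> _]eq_bigr do rewrite gE0 gE1.
Qed.

End pair_products.

(** * Unbiasedness of the estimator *)

Lemma measurable_A_estimator d (Omega : measurableType d) (R : realType) (n l N : nat)
    (Y : 'I_N -> Omega -> n.-tuple R) :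
  (forall i, measurable_fun setT (Y i)) ->
  measurable_fun setT (fun o => A_estimator l (fun i => Y i o)).
Proof.
move=> mY; apply: measurable_funM => //.
rewrite (_ : (fun o => _) = fun o =>
    \sum_(t <- enum [pred t : (2 * l).-tuple 'I_N | uniq t]) \prod_(k < l)
      dotp (Y (tnth t (Ordinal (even_index_lt k))) o)
           (Y (tnth t (Ordinal (odd_index_lt k))) o)); last first.
  by apply/funext => o; rewrite big_enum.
apply: measurable_sum => t; apply: measurable_prod => k _.
apply: measurable_sum => j; apply: measurable_funM;
  exact: (measurableT_comp (measurable_tnth j) (mY _)).
Qed.

Unset Implicit Arguments.

Theorem theorem4p3 (R : realType) (n l N : nat) (hn : (2 <= n)%N)
    (hl : (1 <= l)%N) (hN : (2 * l <= N)%N)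
    (mu : n.-tuple R) (hmu : unit_sphere n mu) (kappa : R) (hkappa : 0 < kappa)
    (d : measure_display) (Omega : measurableType d) (P : probability Omega R)
    (X : 'I_N -> {RV P >-> n.-tuple R})
    (X_indep : mutually_independent X)
    (X_dist : forall (i : 'I_N) (A : set (n.-tuple R)), measurable A ->
      distribution P (X i) A = FvML mu kappa A) :
  'E_P[fun w => A_estimator l (fun i => X i w)]%E =
    (bessel_ratio n kappa ^+ (2 * l))%:E.
Proof.
pose c (j : 'I_n) (x : n.-tuple R) := tnth (unit_vec x) j.
have mc j : measurable_fun setT (c j).
  exact: (measurableT_comp (measurable_tnth j) measurable_unit_vec).
have c1 j x : `|c j x| <= 1 by exact: cube_unit_vec.
set a := bessel_ratio n kappa.
have EX i j : \int[P]_o c j (X i o) = tnth mu j * a.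
  by apply: FvML_coord_mean => //; exact: X_dist.
(* One term of the expansion of a product of [l] inner products: [f] picks a coordinate in each of
   them. *)
pose F (t : (2 * l).-tuple 'I_N) (f : {ffun 'I_l -> 'I_n}) (o : Omega) : R :=
  \prod_(k < l) (c (f k) (X (tnth t (Ordinal (even_index_lt k))) o) *
                 c (f k) (X (tnth t (Ordinal (odd_index_lt k))) o)).
have mF t f : measurable_fun setT (F t f).
  by apply: measurable_prod => k _; apply: measurable_funM; exact: measurableT_comp.
have F1 t f o : `|F t f o| <= 1.
  rewrite normr_prod; apply: prodr_ile1 => k _.
  by rewrite normr_ge0 normrM mulr_ile1.
have iF t f : P.-integrable setT (EFin \o F t f).
  exact: (integrable_probability (C := 1) _ _ (F1 t f)).
have EF (t : (2 * l).-tuple 'I_N) : uniq t ->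
    \sum_(f : {ffun 'I_l -> 'I_n}) \int[P]_o F t f o = a ^+ (2 * l).
  move=> t_uniq.
  under eq_bigr do rewrite independent_pairs//.
  under eq_bigr do under eq_bigr do rewrite !EX.
  (* After expectations are taken, the sum over [f] folds back into a product of [l] equal factors,
     each a^2 mu.mu = a^2. *)
  rewrite -(bigA_distr_bigA (fun (k : 'I_l) j => (tnth mu j * a) * (tnth mu j * a))) /=.
  rewrite prodr_const card_ord exprM; congr (_ ^+ l).
  rewrite (_ : \sum_(j < n) _ = a ^+ 2 * dotp mu mu).
    by rewrite -norm2_sqr hmu expr1n mulr1.
  by rewrite /dotp mulr_sumr; apply: eq_bigr => j _; ring.
have estE o : A_estimator l (fun i => unit_vec (X i o)) =
    (N ^_ (2 * l))%:R^-1 *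
    (\sum_(t <- enum [pred t : (2 * l).-tuple 'I_N | uniq t])
       \sum_(f <- enum {: {ffun 'I_l -> 'I_n}}) F t f o).
  rewrite /A_estimator mulrC; congr (_ * _).
  rewrite /D_stat big_enum /=; apply: eq_bigr => t _.
  by rewrite /dotp bigA_distr_bigA big_enum.
rewrite unlock.
(* Almost surely all observations are on the sphere, where normalization changes nothing; the
   normalized estimator is a combination of bounded terms. *)
transitivity (\int[P]_o (A_estimator l (fun i => unit_vec (X i o)))%:E)%E.
  apply: ae_eq_integral => //.
  - by apply/measurable_EFinP; exact: measurable_A_estimator.
  - apply/measurable_EFinP; apply: measurable_A_estimator => i.
    exact: (measurableT_comp measurable_unit_vec).
  - have : {ae P, forall o i, unit_sphere n (X i o)}.
      apply: filter_forall => i; apply: (FvML_ae_sphere (mu := mu) (kappa := kappa)).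
      exact: X_dist.
    apply: filterS => o oS _; congr EFin; congr (A_estimator l _).
    by apply/funext => i; rewrite unit_vec_sphere.
have iS t : P.-integrable setT (EFin \o (fun o =>
    \sum_(f <- enum {: {ffun 'I_l -> 'I_n}}) F t f o)).
  by apply: integrable_sum_EFin => // f _.
have iSS : P.-integrable setT (EFin \o (fun o =>
    \sum_(t <- enum [pred t : (2 * l).-tuple 'I_N | uniq t])
      \sum_(f <- enum {: {ffun 'I_l -> 'I_n}}) F t f o)).
  by apply: integrable_sum_EFin => // t _.
under eq_integral do rewrite estE.
rewrite -[LHS]fineK; last first.
  by apply: integrable_fin_num => //; exact: integrableZl_EFin.
congr EFin; rewrite -/(Rintegral _ _ _) RintegralZl// Rintegral_sum//.
under eq_bigr do rewrite Rintegral_sum// big_enum.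
rewrite big_enum /=.
rewrite (eq_bigr (fun=> a ^+ (2 * l))); last by move=> t; rewrite inE => /EF.
rewrite sumr_const -[X in _ * X = _]mulr_natl mulrA.
(* Every admissible tuple contributes the same value, so only their number matters; it is the
   falling factorial, nonzero because [2 * l <= N]. *)
have -> : #|[pred t : (2 * l).-tuple 'I_N | uniq t]| = (N ^_ (2 * l))%N.
  rewrite -[N in RHS]card_ord -(card_uniq_tuples _ predT).
  by apply: eq_card => t; rewrite !inE all_predT.
by rewrite mulVf ?mul1r// pnatr_eq0 -lt0n ffact_gt0.
Qed.
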